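(* Let $\alpha\in\mathbb{R}$ and $\beta\in\mathbb{R}\setminus\mathbb{Z}$, and define, with $\sigma_{\alpha,\beta}(z)=[(1+\alpha+\beta)^2+4z]^{1/2}$, $$\widehat m_{\alpha,\beta}(z)=\frac{-\Gamma(1-\beta)}{2^{1+\alpha+\beta}\beta\Gamma(1+\beta)}\,\frac{\Gamma([1+\alpha+\beta+\sigma_{\alpha,\beta}(z)]/2)\,\Gamma([1+\alpha+\beta-\sigma_{\alpha,\beta}(z)]/2)}{\Gamma([1+\alpha-\beta+\sigma_{\alpha,\beta}(z)]/2)\,\Gamma([1+\alpha-\beta-\sigma_{\alpha,\beta}(z)]/2)},$$ for $z\in\mathbb{C}\setminus\{n(n+1+\alpha+\beta)\}_{n\in\mathbb{N}_0}$. Then $\widehat m_{\alpha,\beta}$ has the Nevanlinna--Herglotz property if and only if $\alpha\in(-\mathbb{N})\cup(-1,\infty)$ and $\beta\in(-1,0)\cup(0,1)$.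
   Context: A function $m$ has the Nevanlinna--Herglotz property if it is analytic in the open upper half-plane $\mathbb{C}_+$ and satisfies $\operatorname{Im}(m(z))>0$ for all $z\in\mathbb{C}_+$. The expression defining $\widehat m_{\alpha,\beta}$ is even in $\sigma_{\alpha,\beta}(z)$, so the branch of the square root is irrelevant. $\mathbb{N}_0=\mathbb{N}\cup\{0\}$. *)

(* Defs.v *)
From Stdlib Require Import Reals.
From Coquelicot Require Export Coquelicot.
Open Scope R_scope.

Definition Cexp (z : C) : C :=
  (exp (Re z) * cos (Im z), exp (Re z) * sin (Im z)).

(* principal complex square root (branch irrelevant for m_hat) *)
Definition Csqrt (w : C) : C :=
  (sqrt ((Cmod w + Re w) / 2),
   (if Rle_dec 0 (Im w) then 1 else -1) * sqrt ((Cmod w - Re w) / 2)).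

Fixpoint Cpoch (z : C) (n : nat) : C :=
  match n with
  | O => z
  | S m => Cmult (Cpoch z m) (Cplus z (RtoC (INR (S m))))
  end.

(* Gauss' product: Gamma(z) = lim_n n! n^z / (z (z+1) ... (z+n)),
   with n^z = exp(z ln n).  Valid for z not in -N0 (off that set it is junk). *)
Definition Gauss_seq (z : C) (n : nat) : C :=
  Cdiv (Cmult (RtoC (INR (Factorial.fact n))) (Cexp (Cmult z (RtoC (ln (INR n))))))
       (Cpoch z n).

Definition CGamma (z : C) : C :=
  (real (Lim_seq (fun n => Re (Gauss_seq z n))),
   real (Lim_seq (fun n => Im (Gauss_seq z n)))).

Definition sigma_ab (a b : R) (z : C) : C :=
  Csqrt (Cplus (RtoC ((1 + a + b) ^ 2)) (Cmult (RtoC 4) z)).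

Definition m_hat (a b : R) (z : C) : C :=
  let s := sigma_ab a b z in
  Cmult
    (Cdiv (Copp (CGamma (RtoC (1 - b))))
          (Cmult (RtoC (Rpower 2 (1 + a + b) * b)) (CGamma (RtoC (1 + b)))))
    (Cdiv (Cmult (CGamma (Cdiv (Cplus (RtoC (1 + a + b)) s) (RtoC 2)))
                 (CGamma (Cdiv (Cminus (RtoC (1 + a + b)) s) (RtoC 2))))
          (Cmult (CGamma (Cdiv (Cplus (RtoC (1 + a - b)) s) (RtoC 2)))
                 (CGamma (Cdiv (Cminus (RtoC (1 + a - b)) s) (RtoC 2))))).

Definition Herglotz (m : C -> C) : Prop :=
  forall z : C, 0 < Im z -> ex_derive m z /\ 0 < Im (m z).

(* Main.v *)
(** Put [c = (1 + alpha + beta) / 2], [d = c - beta] and [w = z + c^2]. Gauss' product for the four Gamma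
    factors gives [m_hat z = K * lim_n G_n(w)] with a nonzero real [K] and
      [G_n(w) = n^(2 (c - d)) * prod_(k <= n) ((d + k)^2 - w) / ((c + k)^2 - w)],
    so [m_hat] has zeros at [w = (d + k)^2] and poles at [w = (c + k)^2].

    If the conditions on [alpha] and [beta] hold then, after cancelling finitely many common factors, zeros
    and poles interlace; the argument of [G_n(w)] is an alternating sum of increasing angles and stays in a
    compact part of [(-PI, 0)] (or of [(0, PI)]), which fixes the sign of [Im m_hat].

    Conversely, going around a real point [u] in the upper half-plane changes the argument by [PI] times the
    order of [m_hat] at [u]. Since the argument must stay in [[0, PI]] (mod [2 PI]), the number of zeros minus
    the number of poles below [u] is in [{0, 1}] for all [u], or in [{0, -1}] for all [u]. This fails far to
    the right if [|beta| > 1], and near the origin of the lattices if [alpha < -1] is not an integer. *)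
Require Import Defs.
From Stdlib Require Import Reals Lra Lia Psatz ZArith.
From Coquelicot Require Import Coquelicot.
Open Scope R_scope.

(** * Convergence of complex sequences *)

(** [CGamma] is built from [Lim_seq], which returns a value even for a divergent sequence, so every
    statement about [m_hat] has to pass through a proof that Gauss' product converges. The work is
    done at nonreal [w], where no factor vanishes or blows up. Convergence, nonvanishing and
    differentiability rest on one kind of estimate: successive ratios, or factors perturbed by [h],
    differ from 1 by a multiple of [1 / (n (n + 1))], whose sum telescopes. No theory of holomorphic
    functions enters.

    A strict sign need not survive a limit. This is why the argument must be confined to a compact
    interval and why the limit must be known to be nonzero. In the converse, a value [(c + k)^2] can
    occur twice and zeros can meet poles, so only net orders, counted with multiplicity, make sense.
    The sign of [K] is known only for [|beta| < 1]; for larger [|beta|] both alternatives stay open,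
    and an excess of two refutes either. *)

Definition Cconv (u : nat -> C) (l : C) : Prop :=
  is_lim_seq (fun n => Re (u n)) (Re l) /\ is_lim_seq (fun n => Im (u n)) (Im l).

Lemma Cmod_le_Re_Im (z : C) : Cmod z <= Rabs (Re z) + Rabs (Im z).
Proof.
  replace z with ((RtoC (Re z)) + (RtoC (Im z) * Ci))%C at 1.
  2:{ destruct z as [x y]. apply injective_projections; simpl; ring. }
  eapply Rle_trans; [apply Cmod_triangle|].
  rewrite Cmod_mult, !Cmod_R, Cmod_Ci; lra.
Qed.

Lemma im_le_Cmod (z : C) : Rabs (Im z) <= Cmod z.
Proof. eapply Rle_trans; [apply Rmax_r|apply Rmax_Cmod]. Qed.

Lemma is_lim_seq_of_dominated (u v : nat -> R) (l : R) :
  (forall n, Rabs (u n - l) <= v n) -> is_lim_seq v 0 -> is_lim_seq u l.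
Proof.
  intros H Hv.
  apply is_lim_seq_ext with (fun n => l + (u n - l)).
  { intros n; ring. }
  rewrite <- (Rplus_0_r l) at 1.
  apply is_lim_seq_plus'; [apply is_lim_seq_const|].
  apply is_lim_seq_abs_0.
  apply is_lim_seq_le_le with (u := fun _ => 0) (w := v).
  - intros n; split; [apply Rabs_pos|apply H].
  - apply is_lim_seq_const.
  - exact Hv.
Qed.

Lemma Cconv_Cmod_minus (u : nat -> C) (l : C) :
  Cconv u l <-> is_lim_seq (fun n => Cmod (u n - l)) 0.
Proof.
  split.
  - intros [H1 H2].
    apply is_lim_seq_le_le with (u := fun _ => 0)
      (w := fun n => Rabs (Re (u n) - Re l) + Rabs (Im (u n) - Im l)).
    + intros n; split; [apply Cmod_ge_0|].
      exact (Cmod_le_Re_Im (u n - l)%C).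
    + apply is_lim_seq_const.
    + replace 0 with (Rabs (Re l - Re l) + Rabs (Im l - Im l))
        by (rewrite !Rminus_diag, Rabs_R0; ring).
      apply is_lim_seq_plus'.
      * apply (is_lim_seq_abs (fun n => Re (u n) - Re l) (Re l - Re l)).
        apply is_lim_seq_minus'; [exact H1|apply is_lim_seq_const].
      * apply (is_lim_seq_abs (fun n => Im (u n) - Im l) (Im l - Im l)).
        apply is_lim_seq_minus'; [exact H2|apply is_lim_seq_const].
  - intros H; split; apply is_lim_seq_of_dominated with (2 := H); intros n.
    + exact (re_le_Cmod (u n - l)%C).
    + exact (im_le_Cmod (u n - l)%C).
Qed.

Lemma Cconv_Cmod (u : nat -> C) (l : C) :
  Cconv u l -> is_lim_seq (fun n => Cmod (u n)) (Cmod l).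
Proof.
  intros H. apply Cconv_Cmod_minus in H.
  apply is_lim_seq_of_dominated with (2 := H). intros n.
  apply Rabs_le; split.
  - assert (H1 := Cmod_triangle (l - u n) (u n)).
    replace (l - u n + u n)%C with l in H1 by ring.
    rewrite <- (Cmod_opp (l - u n)) in H1.
    replace (- (l - u n))%C with (u n - l)%C in H1 by ring. lra.
  - assert (H1 := Cmod_triangle (u n - l) l).
    replace (u n - l + l)%C with (u n) in H1 by ring. lra.
Qed.

Lemma Cconv_const (a : C) : Cconv (fun _ => a) a.
Proof. split; apply is_lim_seq_const. Qed.

Lemma Cconv_ext (u v : nat -> C) (l : C) :
  (forall n, u n = v n) -> Cconv u l -> Cconv v l.
Proof.
  intros H [H1 H2]; split.
  - apply is_lim_seq_ext with (2 := H1). intros n; now rewrite H.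
  - apply is_lim_seq_ext with (2 := H2). intros n; now rewrite H.
Qed.

Lemma Cconv_plus (u v : nat -> C) (a b : C) :
  Cconv u a -> Cconv v b -> Cconv (fun n => u n + v n)%C (a + b)%C.
Proof. intros [H1 H2] [H3 H4]; split; apply is_lim_seq_plus'; assumption. Qed.

Lemma Cconv_opp (u : nat -> C) (a : C) : Cconv u a -> Cconv (fun n => - u n)%C (- a)%C.
Proof.
  intros [H1 H2]; split.
  - exact (proj1 (is_lim_seq_opp _ _) H1).
  - exact (proj1 (is_lim_seq_opp _ _) H2).
Qed.

Lemma Cconv_mult (u v : nat -> C) (a b : C) :
  Cconv u a -> Cconv v b -> Cconv (fun n => u n * v n)%C (a * b)%C.
Proof.
  intros [H1 H2] [H3 H4]; split.
  - apply is_lim_seq_minus'; apply is_lim_seq_mult'; assumption.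
  - apply is_lim_seq_plus'; apply is_lim_seq_mult'; assumption.
Qed.

Lemma Cconv_inv (u : nat -> C) (a : C) :
  a <> 0 -> Cconv u a -> Cconv (fun n => / u n)%C (/ a)%C.
Proof.
  intros Ha [H1 H2].
  assert (Hd : is_lim_seq (fun n => Re (u n) ^ 2 + Im (u n) ^ 2) (Re a ^ 2 + Im a ^ 2)).
  { simpl. apply is_lim_seq_plus';
      repeat (apply is_lim_seq_mult'; try assumption; try apply is_lim_seq_const). }
  assert (Hn : Re a ^ 2 + Im a ^ 2 <> 0).
  { rewrite <- Cmod2_alt. apply pow_nonzero. intros E. apply Ha, Cmod_eq_0, E. }
  split.
  - apply (is_lim_seq_div' _ _ _ _ H1 Hd Hn).
  - refine (is_lim_seq_div' _ _ _ _ _ Hd Hn).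
    apply (is_lim_seq_opp (fun n => Im (u n)) (Im a)), H2.
Qed.

Lemma Cconv_div (u v : nat -> C) (a b : C) :
  b <> 0 -> Cconv u a -> Cconv v b -> Cconv (fun n => u n / v n)%C (a / b)%C.
Proof.
  intros Hb Hu Hv. apply Cconv_mult; [assumption|now apply Cconv_inv].
Qed.

Lemma Cconv_unique (u : nat -> C) (a b : C) : Cconv u a -> Cconv u b -> a = b.
Proof.
  intros [H1 H2] [H3 H4]. apply injective_projections.
  - apply is_lim_seq_unique in H1. apply is_lim_seq_unique in H3.
    rewrite H1 in H3. now injection H3.
  - apply is_lim_seq_unique in H2. apply is_lim_seq_unique in H4.
    rewrite H2 in H4. now injection H4.
Qed.

Lemma Cmod_le_lim (u : nat -> C) (l : C) (B : R) :
  eventually (fun n => Cmod (u n) <= B) -> Cconv u l -> Cmod l <= B.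
Proof.
  intros He Hu. apply Cconv_Cmod in Hu.
  exact (is_lim_seq_le_loc _ (fun _ => B) (Cmod l) B He Hu (is_lim_seq_const B)).
Qed.

(** * Convergence from telescoping bounds on increments and ratios *)

Lemma inv_telescope (n : nat) :
  (1 <= n)%nat -> / INR n - / INR (S n) = / (INR n * INR (S n)).
Proof.
  intros Hn. rewrite S_INR. assert (1 <= INR n) by (apply (le_INR 1), Hn).
  field. lra.
Qed.

Lemma is_lim_seq_inv_INR : is_lim_seq (fun n => / INR n) 0.
Proof.
  apply (is_lim_seq_inv INR p_infty); [apply is_lim_seq_INR|easy].
Qed.

(* With C/n added or subtracted, u becomes monotone. *)
Lemma ex_lim_seq_of_summable_steps (u : nat -> R) (B : R) (n0 : nat) :
  (1 <= n0)%nat ->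
  (forall n, (n0 <= n)%nat -> Rabs (u (S n) - u n) <= B * / (INR n * INR (S n))) ->
  ex_finite_lim_seq u.
Proof.
  intros Hn0 H.
  set (v := fun n => u (n + n0)%nat - B * / INR (n + n0)).
  assert (Hstep : forall n, v n <= v (S n) /\
     u (S n + n0)%nat + B * / INR (S n + n0) <= u (n + n0)%nat + B * / INR (n + n0)).
  { intros n. unfold v.
    specialize (H (n + n0)%nat (Nat.le_add_l n0 n)). change (S n + n0)%nat with (S (n + n0)).
    rewrite <- (inv_telescope (n + n0)) in H by (clear - Hn0; lia).
    apply Rabs_le_between in H. split; lra. }
  assert (Hub : forall n, v n <= u n0 + 2 * Rabs B + B * / INR n0).
  { assert (Hd : forall n, u (n + n0)%nat + B * / INR (n + n0) <= u n0 + B * / INR n0).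
    { induction n; [simpl; lra|]. destruct (Hstep n) as [_ Hs]. lra. }
    intros n. specialize (Hd n). unfold v.
    assert (0 < / INR (n + n0) <= 1).
    { assert (1 <= INR (n + n0)) by (apply (le_INR 1); lia).
      split; [apply Rinv_0_lt_compat; lra|].
      rewrite <- Rinv_1. apply Rinv_le_contravar; lra. }
    assert (Rabs (B * / INR (n + n0)) <= Rabs B).
    { rewrite Rabs_mult, (Rabs_pos_eq (/ _)) by lra.
      assert (H1 := Rabs_pos B). nra. }
    apply Rabs_le_between in H1. lra. }
  destruct (ex_finite_lim_seq_incr v _ (fun n => proj1 (Hstep n)) Hub) as [l Hl].
  exists (l + B * 0). apply (is_lim_seq_incr_n u n0).
  apply is_lim_seq_ext with (fun n => v n + B * / INR (n + n0)).
  { intros n; unfold v; ring. }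
  apply is_lim_seq_plus'; [exact Hl|].
  apply is_lim_seq_mult'; [apply is_lim_seq_const|].
  apply (is_lim_seq_incr_n (fun n => / INR n) n0), is_lim_seq_inv_INR.
Qed.

Lemma Cconv_of_summable_steps (u : nat -> C) (B : R) (n0 : nat) :
  (1 <= n0)%nat ->
  (forall n, (n0 <= n)%nat -> Cmod (u (S n) - u n) <= B * / (INR n * INR (S n))) ->
  exists l, Cconv u l.
Proof.
  intros Hn0 H.
  destruct (ex_lim_seq_of_summable_steps (fun n => Re (u n)) B n0 Hn0) as [a Ha].
  { intros n Hn. eapply Rle_trans; [|apply (H n Hn)].
    exact (re_le_Cmod (u (S n) - u n)%C). }
  destruct (ex_lim_seq_of_summable_steps (fun n => Im (u n)) B n0 Hn0) as [b Hb].
  { intros n Hn. eapply Rle_trans; [|apply (H n Hn)].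
    exact (im_le_Cmod (u (S n) - u n)%C). }
  exists (a, b). split; assumption.
Qed.

Lemma inv_INR_prod_pos (n : nat) : (1 <= n)%nat -> 0 < / (INR n * INR (S n)).
Proof.
  intros Hn. assert (1 <= INR n) by (apply (le_INR 1), Hn).
  apply Rinv_0_lt_compat, Rmult_lt_0_compat; rewrite ?S_INR; lra.
Qed.

(** By [1 + x <= exp x] and telescoping, [Cmod (u n) * exp (B / n)] is nonincreasing from [n0] on.
    Hence [u] is bounded there and the relative bound on the steps becomes an absolute one. *)
Lemma Cconv_of_summable_ratios (u : nat -> C) (B : R) (n0 : nat) :
  (1 <= n0)%nat -> 0 <= B ->
  (forall n, (n0 <= n)%nat ->
     Cmod (u (S n) - u n) <= Cmod (u n) * (B * / (INR n * INR (S n)))) ->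
  exists l, Cconv u l.
Proof.
  intros Hn0 HB H.
  set (M := Cmod (u n0) * exp (B * / INR n0)).
  assert (Hb : forall k, Cmod (u (k + n0)%nat) * exp (B * / INR (k + n0)) <= M).
  { induction k; [apply Rle_refl|].
    eapply Rle_trans; [|exact IHk].
    specialize (H (k + n0)%nat ltac:(lia)).
    assert (Ht : Cmod (u (S k + n0)%nat) <=
              Cmod (u (k + n0)%nat) * (1 + B * / (INR (k + n0) * INR (S (k + n0))))).
    { assert (H1 := Cmod_triangle (u (S k + n0)%nat - u (k + n0)%nat) (u (k + n0)%nat)).
      replace (u (S k + n0)%nat - u (k + n0)%nat + u (k + n0)%nat)%C
        with (u (S k + n0)%nat) in H1 by ring.
      change (S k + n0)%nat with (S (k + n0)) in *. lra. }
    rewrite <- inv_telescope in Ht by lia.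
    set (x := B * (/ INR (k + n0) - / INR (S (k + n0)))) in *.
    assert (He := exp_ineq1_le x).
    replace (B * / INR (k + n0)) with (x + B * / INR (S k + n0))
      by (unfold x; change (S k + n0)%nat with (S (k + n0)); ring).
    rewrite exp_plus.
    assert (0 < exp (B * / INR (S k + n0))) by apply exp_pos.
    assert (0 <= Cmod (u (k + n0)%nat)) by apply Cmod_ge_0.
    rewrite <- Rmult_assoc. apply Rmult_le_compat_r; [lra|].
    eapply Rle_trans; [exact Ht|]. apply Rmult_le_compat_l; lra. }
  apply Cconv_of_summable_steps with (B := M * B) (n0 := n0); [assumption|].
  intros n Hn. eapply Rle_trans; [apply (H n Hn)|].
  rewrite Rmult_assoc. apply Rmult_le_compat_r.
  { apply Rmult_le_pos; [lra|]. apply Rlt_le, inv_INR_prod_pos; lia. }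
  specialize (Hb (n - n0)%nat). replace (n - n0 + n0)%nat with n in Hb by lia.
  assert (1 <= exp (B * / INR n)).
  { assert (0 <= B * / INR n).
    { apply Rmult_le_pos; [lra|]. apply Rlt_le, Rinv_0_lt_compat.
      apply lt_0_INR; lia. }
    assert (He := exp_ineq1_le (B * / INR n)). lra. }
  assert (0 <= Cmod (u n)) by apply Cmod_ge_0. nra.
Qed.

(* The hypothesis is essentially invariant under u -> 1/u, so both sequences converge. *)
Lemma Cconv_nonzero_of_summable_ratios (u : nat -> C) (B : R) (n0 : nat) :
  (1 <= n0)%nat -> 0 <= B -> (forall n, u n <> 0) ->
  (forall n, (n0 <= n)%nat ->
     Cmod (u (S n) - u n) <= Cmod (u n) * (B * / (INR n * INR (S n)))) ->
  exists l : C, l <> 0 /\ Cconv u l.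
Proof.
  intros Hn0 HB Hnz H.
  destruct (Cconv_of_summable_ratios u B n0 Hn0 HB H) as [l Hl].
  exists l; split; [|exact Hl].
  (* For [n > 2 B] a step changes the modulus by at most half, so
     [Cmod (u (S n)) >= Cmod (u n) / 2]; passing to reciprocals then only doubles the constant
     [B]. *)
  destruct (nfloor_ex (2 * B) ltac:(lra)) as [N [_ HN]].
  destruct (Cconv_of_summable_ratios (fun n => / u n)%C (2 * B) (n0 + S N)) as [l' Hl'];
    [lia|lra| |].
  - intros n Hn. specialize (H n ltac:(lia)).
    assert (Hx : B * / (INR n * INR (S n)) <= / 2).
    { assert (INR (n0 + S N) <= INR n) by now apply le_INR.
      rewrite plus_INR, S_INR in H0.
      assert (1 <= INR n0) by (apply (le_INR 1); lia).
      rewrite S_INR.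
      assert (0 < INR n * (INR n + 1)) by nra.
      apply (Rmult_le_reg_r (INR n * (INR n + 1))); [lra|].
      rewrite Rmult_assoc, Rinv_l by lra. nra. }
    set (x := B * / (INR n * INR (S n))) in *.
    assert (P : 0 < Cmod (u n)) by (apply Cmod_gt_0, Hnz).
    assert (P' : 0 < Cmod (u (S n))) by (apply Cmod_gt_0, Hnz).
    assert (Hh : Cmod (u n) / 2 <= Cmod (u (S n))).
    { assert (H1 := Cmod_triangle (u n - u (S n)) (u (S n))).
      replace (u n - u (S n) + u (S n))%C with (u n) in H1 by ring.
      rewrite <- (Cmod_opp (u n - u (S n))) in H1.
      replace (- (u n - u (S n)))%C with (u (S n) - u n)%C in H1 by ring. nra. }
    replace (/ u (S n) - / u n)%C with (- (u (S n) - u n) / (u n * u (S n)))%C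
      by (field; split; apply Hnz).
    rewrite Cmod_div, Cmod_opp, Cmod_mult, Cmod_inv
      by (try apply Cmult_neq_0; apply Hnz).
    rewrite Rmult_assoc; fold x.
    apply (Rmult_le_reg_r (Cmod (u n) * Cmod (u (S n)))); [nra|].
    unfold Rdiv. rewrite Rmult_assoc, Rinv_l by nra.
    replace (/ Cmod (u n) * (2 * x) * (Cmod (u n) * Cmod (u (S n))))
      with (2 * x * Cmod (u (S n))) by (field; lra).
    assert (0 <= x).
    { apply Rmult_le_pos; [lra|]. apply Rlt_le, inv_INR_prod_pos; lia. }
    nra.
  - intros E. subst l.
    assert (Hm := Cconv_mult _ _ _ _ Hl Hl'). rewrite Cmult_0_l in Hm.
    assert (H1 : Cconv (fun n => u n * / u n)%C 1).
    { apply Cconv_ext with (fun _ => RtoC 1); [|apply Cconv_const].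
      intros n. now rewrite Cinv_r. }
    apply C1_nz. exact (Cconv_unique _ _ _ H1 Hm).
Qed.

Lemma is_C_derive_of_quadratic_error (m : C -> C) (z l : C) (B delta : R) :
  0 < delta -> 0 <= B ->
  (forall h, Cmod h < delta -> Cmod (m (z + h)%C - m z - h * l) <= B * Cmod h ^ 2) ->
  is_derive m z l.
Proof.
  intros Hd HB H. split.
  - apply is_linear_scal_l.
  - intros x Hx. apply (@is_filter_lim_locally_unique _ (AbsRing_NormedModule C_AbsRing)) in Hx. subst x.
    intros eps.
    (* [B + 1] instead of [B] keeps the radius meaningful when [B = 0]. *)
    assert (Hr : 0 < Rmin delta (eps / (B + 1))).
    { apply Rmin_pos; [lra|]. apply Rdiv_lt_0_compat; [apply cond_pos|lra]. }
    exists (mkposreal _ Hr). intros y Hy. change C in y.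
    change (Cmod (y - z) < Rmin delta (eps / (B + 1))) in Hy.
    change (Cmod (m y - m z - (y - z) * l) <= eps * Cmod (y - z)).
    assert (H1 : Cmod (y - z) < delta) by (eapply Rlt_le_trans; [exact Hy|apply Rmin_l]).
    assert (H2 : Cmod (y - z) < eps / (B + 1))
      by (eapply Rlt_le_trans; [exact Hy|apply Rmin_r]).
    specialize (H (y - z)%C H1). replace (z + (y - z))%C with y in H by ring.
    eapply Rle_trans; [exact H|].
    assert (0 <= Cmod (y - z)) by apply Cmod_ge_0.
    assert (Cmod (y - z) * (B + 1) < eps).
    { apply (Rmult_lt_compat_r (B + 1)) in H2; [|lra].
      unfold Rdiv in H2. rewrite Rmult_assoc, Rinv_l in H2; lra. }
    simpl. rewrite Rmult_1_r, <- Rmult_assoc. apply Rmult_le_compat_r; nra.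
Qed.

(** * Finite products and the exponential *)

Fixpoint Cprod (f : nat -> C) (n : nat) : C :=
  match n with O => RtoC 1 | S m => Cmult (Cprod f m) (f m) end.

Fixpoint Csum (f : nat -> C) (n : nat) : C :=
  match n with O => RtoC 0 | S m => Cplus (Csum f m) (f m) end.

Fixpoint Rsum (f : nat -> R) (n : nat) : R :=
  match n with O => 0 | S m => Rsum f m + f m end.

Lemma Cprod_neq_0 (f : nat -> C) (n : nat) :
  (forall k, (k < n)%nat -> f k <> 0) -> Cprod f n <> 0.
Proof.
  induction n; intros H; simpl; [exact C1_nz|].
  apply Cmult_neq_0; auto.
Qed.

Lemma Cprod_ext (f g : nat -> C) (n : nat) :
  (forall k, (k < n)%nat -> f k = g k) -> Cprod f n = Cprod g n.
Proof.
  induction n; intros H; simpl; [reflexivity|].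
  rewrite IHn, H; auto.
Qed.

Lemma Cprod_mult (f g : nat -> C) (n : nat) :
  Cprod (fun k => f k * g k)%C n = (Cprod f n * Cprod g n)%C.
Proof. induction n; simpl; [ring|rewrite IHn; ring]. Qed.

Lemma Cprod_add (f : nat -> C) (m n : nat) :
  Cprod f (m + n) = (Cprod f m * Cprod (fun k => f (m + k)%nat) n)%C.
Proof.
  induction n; simpl; [rewrite Nat.add_0_r; ring|].
  rewrite Nat.add_succ_r; simpl. rewrite IHn; ring.
Qed.

Lemma Rsum_ext (f g : nat -> R) (n : nat) :
  (forall k, (k < n)%nat -> f k = g k) -> Rsum f n = Rsum g n.
Proof.
  induction n; intros H; simpl; [reflexivity|].
  rewrite IHn, H; auto.
Qed.

Lemma Rsum_add (f : nat -> R) (m n : nat) :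
  Rsum f (m + n) = Rsum f m + Rsum (fun k => f (m + k)%nat) n.
Proof.
  induction n; simpl; [rewrite Nat.add_0_r; ring|].
  rewrite Nat.add_succ_r; simpl. rewrite IHn; ring.
Qed.

Lemma Rsum_minus (f g : nat -> R) (n : nat) :
  Rsum (fun k => f k - g k) n = Rsum f n - Rsum g n.
Proof. induction n; simpl; [ring|rewrite IHn; ring]. Qed.

Lemma Rsum_rev (f : nat -> R) (n : nat) :
  Rsum (fun k => f (n - 1 - k)%nat) n = Rsum f n.
Proof.
  induction n; [reflexivity|].
  change (S n) with (1 + n)%nat at 2. rewrite Rsum_add.
  rewrite (Rsum_ext (fun k => f (S n - 1 - (1 + k))%nat) (fun k => f (n - 1 - k)%nat)).
  - rewrite IHn. simpl. rewrite Nat.sub_0_r, Nat.sub_0_r. ring.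
  - intros k _. f_equal. lia.
Qed.

Lemma Rsum_recip_bound (t : nat -> R) (B : R) (n : nat) :
  (forall k, t k <= B * / (INR (S k) * INR (S (S k)))) ->
  Rsum t n <= B * (1 - / INR (S n)).
Proof.
  intros H. induction n; simpl Rsum.
  - simpl INR. rewrite Rinv_1. lra.
  - specialize (H n). rewrite <- inv_telescope in H by lia. lra.
Qed.

Lemma Cmod_Csum_le (v : nat -> C) (t : nat -> R) (n : nat) :
  (forall k, Cmod (v k) <= t k) -> Cmod (Csum v n) <= Rsum t n.
Proof.
  intros H. induction n; simpl; [rewrite Cmod_0; lra|].
  eapply Rle_trans; [apply Cmod_triangle|]. apply Rplus_le_compat; auto.
Qed.

(** With [e] the error, [s] the sum and [T] the bound after [n] factors, the next error is
    [e + v n * (e + s)]. Since [T <= 1], [Cmod (e + s) <= T^2 + T <= 2 T], and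
    [T^2 + 2 T t <= (T + t)^2]. *)
Lemma Cprod_one_plus (v : nat -> C) (t : nat -> R) (n : nat) :
  (forall k, Cmod (v k) <= t k) -> Rsum t n <= 1 ->
  Cmod (Cprod (fun k => 1 + v k)%C n - 1 - Csum v n) <= Rsum t n ^ 2.
Proof.
  intros H. induction n; simpl Rsum; intros HT.
  - simpl. replace (1 - 1 - 0)%C with (RtoC 0) by ring. rewrite Cmod_0. lra.
  - assert (Hn := H n). assert (H0 := Cmod_ge_0 (v n)).
    specialize (IHn ltac:(lra)).
    assert (Hs := Cmod_Csum_le v t n H).
    assert (Hs0 := Cmod_ge_0 (Csum v n)).
    simpl Cprod. simpl Csum.
    set (p := Cprod (fun k => 1 + v k)%C n) in *. set (s := Csum v n) in *.
    set (T := Rsum t n) in *.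
    replace (p * (1 + v n) - 1 - (s + v n))%C with ((p - 1 - s) + v n * ((p - 1 - s) + s))%C
      by ring.
    eapply Rle_trans; [apply Cmod_triangle|]. rewrite Cmod_mult.
    assert (H1 := Cmod_triangle (p - 1 - s) s).
    set (e := Cmod (p - 1 - s)) in *.
    assert (He : 0 <= e) by apply Cmod_ge_0.
    assert (Cmod (v n) * Cmod (p - 1 - s + s) <= t n * (2 * T)).
    { apply Rmult_le_compat; [assumption|apply Cmod_ge_0|assumption|]. nra. }
    nra.
Qed.

Lemma Cprod_one_plus_near_1 (v : nat -> C) (t : nat -> R) (n : nat) :
  (forall k, Cmod (v k) <= t k) -> Rsum t n <= 1 ->
  Cmod (Cprod (fun k => 1 + v k)%C n - 1) <= 2 * Rsum t n.
Proof.
  intros H HT.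
  assert (H1 := Cprod_one_plus v t n H HT).
  assert (Hs := Cmod_Csum_le v t n H).
  assert (Hs0 := Cmod_ge_0 (Csum v n)).
  set (p := Cprod _ n) in *.
  replace (p - 1)%C with ((p - 1 - Csum v n) + Csum v n)%C by ring.
  eapply Rle_trans; [apply Cmod_triangle|]. nra.
Qed.

(** * Second-order bounds for the exponential *)

Lemma Cexp_plus (z w : C) : Cexp (z + w) = (Cexp z * Cexp w)%C.
Proof.
  unfold Cexp. rewrite re_plus, im_plus, exp_plus, cos_plus, sin_plus.
  apply injective_projections; simpl; ring.
Qed.

Lemma Cexp_RtoC (x : R) : Cexp x = exp x.
Proof.
  unfold Cexp. apply injective_projections; simpl; rewrite ?cos_0, ?sin_0; ring.
Qed.

Lemma Cexp_neq_0 (z : C) : Cexp z <> 0.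
Proof.
  intros E.
  assert (H : Cmod (Cexp z) ^ 2 = exp (Re z) ^ 2 * (Rsqr (sin (Im z)) + Rsqr (cos (Im z)))).
  { rewrite Cmod2_alt. unfold Cexp, Rsqr; simpl. ring. }
  rewrite sin2_cos2, E, Cmod_0 in H.
  assert (H1 := exp_pos (Re z)). nra.
Qed.

(** The inequality [1 + x <= exp x] at [u] and at [- u] gives [1 + u <= exp u <= 1 / (1 - u)], and
    [1 / (1 - u) - 1 - u = u^2 / (1 - u)]. *)
Lemma exp_second_order (u : R) : Rabs u <= / 2 -> Rabs (exp u - 1 - u) <= 2 * u ^ 2.
Proof.
  intros H. apply Rabs_le_between in H.
  assert (H1 := exp_ineq1_le u). assert (H2 := exp_ineq1_le (- u)).
  assert (H3 := exp_pos u).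
  assert (exp u * (1 - u) <= 1).
  { apply Rle_trans with (exp u * exp (- u)).
    - apply Rmult_le_compat_l; lra.
    - rewrite <- exp_plus. replace (u + - u) with 0 by ring. rewrite exp_0; lra. }
  rewrite Rabs_pos_eq by lra. nra.
Qed.

Lemma Rabs_sin_le (x : R) : Rabs (sin x) <= Rabs x.
Proof.
  assert (P : forall x, 0 <= x -> Rabs (sin x) <= x).
  { clear x. intros x Hx. destruct (Rle_lt_dec x 1) as [H1|H1].
    - rewrite Rabs_pos_eq.
      + destruct (Req_dec x 0); [subst; rewrite sin_0; lra|].
        apply Rlt_le, sin_lt_x; lra.
      + apply sin_ge_0; [lra|]. assert (H2 := PI2_1). lra.
    - assert (H2 := SIN_bound x). apply Rabs_le. lra. }
  destruct (Rle_lt_dec 0 x).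
  - rewrite (Rabs_pos_eq x) by lra. now apply P.
  - rewrite <- Rabs_Ropp, <- sin_neg, (Rabs_left x) by lra. apply P; lra.
Qed.

Lemma one_minus_cos_le (v : R) : Rabs (cos v - 1) <= v ^ 2 / 2.
Proof.
  replace v with (2 * (v / 2)) at 1 by field.
  rewrite cos_2a_sin.
  assert (H := Rabs_sin_le (v / 2)).
  replace (1 - 2 * sin (v / 2) * sin (v / 2) - 1) with (- (2 * (sin (v / 2))²))
    by (unfold Rsqr; ring).
  rewrite Rabs_Ropp, Rabs_pos_eq by (assert (H1 := Rle_0_sqr (sin (v / 2))); lra).
  apply Rsqr_le_abs_1 in H. unfold Rsqr in *. lra.
Qed.

Lemma sin_second_order (v : R) : Rabs v <= 1 -> Rabs (sin v - v) <= v ^ 2.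
Proof.
  intros Hv.
  destruct (MVT_gen (fun x => sin x - x) 0 v (fun x => cos x - 1)) as [x [Hx E]].
  - intros x _. auto_derive; [easy|ring].
  - intros x _. apply continuity_pt_minus; [apply continuity_sin|].
    apply derivable_continuous_pt, derivable_pt_id.
  - rewrite sin_0, !Rminus_0_r in E. rewrite E, Rabs_mult.
    assert (H := one_minus_cos_le x).
    assert (Hxv : Rabs x <= Rabs v).
    { unfold Rmin, Rmax in Hx. destruct (Rle_dec 0 v).
      - rewrite !Rabs_pos_eq; lra.
      - rewrite !Rabs_left1; lra. }
    rewrite <- (pow2_abs x) in H. rewrite <- (pow2_abs v).
    assert (Hx0 := Rabs_pos x).
    assert (H0 := Rabs_pos (cos x - 1)). nra.
Qed.

(** Real and imaginary part are each split into two products of the one-variable errors; each part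
    contributes at most [3 * Cmod w ^ 2]. *)
Lemma Cexp_second_order (w : C) :
  Cmod w <= / 2 -> Cmod (Cexp w - 1 - w) <= 6 * Cmod w ^ 2.
Proof.
  intros Hw.
  assert (Hu := re_le_Cmod w). assert (Hv := im_le_Cmod w).
  eapply Rle_trans; [apply Cmod_le_Re_Im|].
  destruct w as [u v]. unfold Cexp, Re, Im in *. simpl in Hu, Hv. simpl fst. simpl snd.
  set (r := Cmod (u, v)) in *.
  assert (He := exp_second_order u ltac:(lra)).
  assert (Hc := one_minus_cos_le v).
  assert (Hs := sin_second_order v ltac:(lra)).
  rewrite <- (pow2_abs u) in He. rewrite <- (pow2_abs v) in Hc, Hs.
  assert (Hu0 := Rabs_pos u). assert (Hv0 := Rabs_pos v).
  assert (Hcb : Rabs (cos v) <= 1) by (apply Rabs_le, COS_bound).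
  assert (Hsb := Rabs_sin_le v).
  assert (He1 : Rabs (exp u - 1) <= 2 * Rabs u).
  { replace (exp u - 1) with ((exp u - 1 - u) + u) by ring.
    eapply Rle_trans; [apply Rabs_triang|]. nra. }
  assert (Hu2 : Rabs u ^ 2 <= r ^ 2) by nra.
  assert (Hv2 : Rabs v ^ 2 <= r ^ 2) by nra.
  assert (Huv : Rabs u * Rabs v <= r ^ 2) by nra.
  replace (exp u * cos v + - (1) + - u) with ((exp u - 1 - u) * cos v + (1 + u) * (cos v - 1))
    by ring.
  replace (exp u * sin v + - 0 + - v) with ((exp u - 1) * sin v + (sin v - v)) by ring.
  apply Rle_trans with ((2 * r ^ 2 + r ^ 2) + (2 * r ^ 2 + r ^ 2)); [|lra].
  apply Rplus_le_compat; (eapply Rle_trans; [apply Rabs_triang|]);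
    apply Rplus_le_compat; rewrite ?Rabs_mult.
  - assert (H := Rabs_pos (exp u - 1 - u)). assert (H' := Rabs_pos (cos v)). nra.
  - assert (Rabs (1 + u) <= 2).
    { eapply Rle_trans; [apply Rabs_triang|]. rewrite Rabs_R1. lra. }
    assert (Hp := Rabs_pos (1 + u)). assert (H' := Rabs_pos (cos v - 1)). nra.
  - assert (Hp := Rabs_pos (exp u - 1)). assert (H' := Rabs_pos (sin v)). nra.
  - lra.
Qed.

(** * Gauss' product for Gamma *)

Lemma Cinv_neq_0 (z : C) : z <> 0 -> (/ z)%C <> 0.
Proof.
  intros Hz E. apply C1_nz. rewrite <- (Cinv_r z Hz), E. ring.
Qed.

Lemma Cpoch_neq_0 (z : C) (n : nat) :
  (forall k : nat, z + INR k <> 0)%C -> Cpoch z n <> 0.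
Proof.
  intros H. induction n; simpl Cpoch.
  - intros E. apply (H O). rewrite E. simpl. ring.
  - apply Cmult_neq_0; [assumption|apply (H (S n))].
Qed.

Lemma Gauss_seq_neq_0 (z : C) (n : nat) :
  (forall k : nat, z + INR k <> 0)%C -> Gauss_seq z n <> 0.
Proof.
  intros H. unfold Gauss_seq, Cdiv. repeat apply Cmult_neq_0.
  - intros E. apply RtoC_inj in E. now apply (INR_fact_neq_0 n).
  - apply Cexp_neq_0.
  - now apply Cinv_neq_0, Cpoch_neq_0.
Qed.

Lemma Gauss_seq_succ (z : C) (n : nat) :
  (forall k : nat, z + INR k <> 0)%C ->
  Gauss_seq z (S n) = (Gauss_seq z n *
    (INR (S n) * Cexp (z * (ln (INR (S n)) - ln (INR n))) / (z + INR (S n))))%C.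
Proof.
  intros H. unfold Gauss_seq.
  replace (z * ln (INR (S n)))%C
    with (z * ln (INR n) + z * (ln (INR (S n)) - ln (INR n)))%C by ring.
  rewrite Cexp_plus.
  change (fact (S n)) with (S n * fact n)%nat. rewrite mult_INR, RtoC_mult.
  change (Cpoch z (S n)) with (Cpoch z n * (z + INR (S n)))%C.
  assert (HS := H (S n)). assert (Hp := Cpoch_neq_0 z n H).
  field. split; assumption.
Qed.

Lemma ln_succ_bounds (n : nat) :
  (1 <= n)%nat ->
  / INR (S n) <= ln (INR (S n)) - ln (INR n) <= / INR n.
Proof.
  intros Hn. assert (1 <= INR n) by (apply (le_INR 1), Hn).
  assert (HS := S_INR n).
  assert (L : forall x, 0 < x -> ln x <= x - 1).
  { intros x Hx. assert (H1 := exp_ineq1_le (ln x)). rewrite exp_ln in H1; lra. }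
  split.
  - assert (H1 := L (INR n / INR (S n)) ltac:(apply Rdiv_lt_0_compat; lra)).
    rewrite ln_div in H1 by lra.
    replace (INR n / INR (S n) - 1) with (- / INR (S n)) in H1 by (rewrite HS; field; lra).
    lra.
  - assert (H1 := L (INR (S n) / INR n) ltac:(apply Rdiv_lt_0_compat; lra)).
    rewrite ln_div in H1 by lra.
    replace (INR (S n) / INR n - 1) with (/ INR n) in H1 by (rewrite HS; field; lra).
    lra.
Qed.

(** With [x = ln (n + 1) - ln n], the ratio of successive terms minus 1 is [((n + 1) (exp (z x) - 1
    - z x) + z ((n + 1) x - 1)) / (z + n + 1)]. The numerator is [O(1 / n)] and the denominator
    grows like [n]. *)
Lemma Gauss_seq_conv (z : C) :
  (forall k : nat, z + INR k <> 0)%C ->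
  exists l : C, l <> 0 /\ Cconv (Gauss_seq z) l.
Proof.
  intros H.
  assert (Hz := Cmod_ge_0 z).
  (* From [n > 2 |z|] follow [|z x| <= 1/2], as [Cexp_second_order] requires, and
     [|z + n + 1| >= (n + 1) / 2]. In the constant, 12 is the 6 of that lemma times
     [(n + 1) / n <= 2], and the outer 2 comes from the denominator. *)
  destruct (nfloor_ex (2 * Cmod z) ltac:(lra)) as [N [_ HN]].
  apply Cconv_nonzero_of_summable_ratios
    with (B := 2 * (12 * Cmod z ^ 2 + Cmod z)) (n0 := S N).
  - lia.
  - nra.
  - intros n. now apply Gauss_seq_neq_0.
  - intros n Hn.
    assert (HnN : INR N + 1 <= INR n) by (rewrite <- S_INR; now apply le_INR).
    assert (Hn1 : 1 <= INR n) by (apply (le_INR 1); lia).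
    rewrite (Gauss_seq_succ z n H).
    set (g := Gauss_seq z n).
    set (x := ln (INR (S n)) - ln (INR n)).
    assert (Hx := ln_succ_bounds n ltac:(lia)). fold x in Hx.
    rewrite <- RtoC_minus. fold x.
    set (D := (z + INR (S n))%C).
    assert (HD : D <> 0) by apply H.
    replace (g * (INR (S n) * Cexp (z * x) / D) - g)%C
      with (g * ((INR (S n) * (Cexp (z * x) - 1 - z * x) + z * RtoC (INR (S n) * x - 1)) / D))%C.
    2:{ rewrite RtoC_minus, RtoC_mult. unfold D. field. exact HD. }
    rewrite Cmod_mult. apply Rmult_le_compat_l; [apply Cmod_ge_0|].
    rewrite Cmod_div by exact HD.
    assert (HSn := S_INR n).
    assert (Hi : 0 < / INR n) by (apply Rinv_0_lt_compat; lra).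
    assert (Hi' : 0 < / INR (S n)) by (apply Rinv_0_lt_compat; lra).
    assert (Hin : / INR n * INR n = 1) by (apply Rinv_l; lra).
    assert (Hin' : / INR (S n) * INR (S n) = 1) by (apply Rinv_l; lra).
    assert (HDl : INR (S n) / 2 <= Cmod D).
    { assert (H1 := Cmod_triangle D (- z)).
      replace (D + - z)%C with (RtoC (INR (S n))) in H1 by (unfold D; ring).
      rewrite Cmod_opp, Cmod_R, Rabs_pos_eq in H1 by lra. lra. }
    assert (Hzx : Cmod (z * x) = Cmod z * x).
    { rewrite Cmod_mult, Cmod_R, Rabs_pos_eq; lra. }
    assert (He : Cmod (Cexp (z * x) - 1 - z * x) <= 6 * (Cmod z * / INR n) ^ 2).
    { eapply Rle_trans.
      - apply Cexp_second_order. rewrite Hzx.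
        apply Rle_trans with (Cmod z * / INR n); [apply Rmult_le_compat_l; lra|]. nra.
      - rewrite Hzx. apply Rmult_le_compat_l; [lra|].
        apply pow_incr. split; [nra|apply Rmult_le_compat_l; lra]. }
    assert (Hnum : Cmod (INR (S n) * (Cexp (z * x) - 1 - z * x) + z * RtoC (INR (S n) * x - 1))
              <= (12 * Cmod z ^ 2 + Cmod z) * / INR n).
    { eapply Rle_trans; [apply Cmod_triangle|].
      rewrite !Cmod_mult, !Cmod_R, (Rabs_pos_eq (INR (S n))), (Rabs_pos_eq (_ - 1)) by nra.
      assert (INR (S n) * x - 1 <= / INR n) by (rewrite HSn in *; nra).
      assert (Hs2 : INR (S n) * / INR n <= 2) by (rewrite HSn; nra).
      apply Rle_trans with (INR (S n) * (6 * (Cmod z * / INR n) ^ 2) + Cmod z * / INR n).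
      - apply Rplus_le_compat; apply Rmult_le_compat_l; lra.
      - replace (INR (S n) * (6 * (Cmod z * / INR n) ^ 2))
          with (6 * (INR (S n) * / INR n) * (Cmod z ^ 2 * / INR n)) by ring.
        assert (0 <= Cmod z ^ 2 * / INR n) by nra. nra. }
    apply (Rmult_le_reg_r (Cmod D)); [lra|].
    unfold Rdiv. rewrite Rmult_assoc, Rinv_l, Rmult_1_r by lra.
    eapply Rle_trans; [exact Hnum|].
    rewrite Rinv_mult.
    set (E := 12 * Cmod z ^ 2 + Cmod z) in *.
    assert (HE : 0 <= E) by (unfold E; nra).
    replace (2 * E * (/ INR n * / INR (S n)) * Cmod D)
      with (E * / INR n * (2 * / INR (S n) * Cmod D)) by ring.
    rewrite <- (Rmult_1_r (E * / INR n)) at 1.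
    apply Rmult_le_compat_l; nra.
Qed.

Lemma CGamma_lim (z l : C) : Cconv (Gauss_seq z) l -> CGamma z = l.
Proof.
  intros [H1 H2]. unfold CGamma.
  rewrite (is_lim_seq_unique _ _ H1), (is_lim_seq_unique _ _ H2).
  now destruct l.
Qed.

Lemma CGamma_conv (z : C) :
  (forall k : nat, z + INR k <> 0)%C ->
  CGamma z <> 0 /\ Cconv (Gauss_seq z) (CGamma z).
Proof.
  intros H. destruct (Gauss_seq_conv z H) as [l [Hl Hc]].
  now rewrite (CGamma_lim z l Hc).
Qed.

Definition Gauss_seq_real (x : R) (n : nat) : R :=
  INR (fact n) * exp (x * ln (INR n)) * / prod_f_R0 (fun k => x + INR k) n.

Lemma Cpoch_RtoC (x : R) (n : nat) :
  Cpoch x n = prod_f_R0 (fun k => x + INR k) n.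
Proof.
  induction n; simpl Cpoch; simpl prod_f_R0.
  - now rewrite Rplus_0_r.
  - rewrite IHn, <- RtoC_plus, <- RtoC_mult. reflexivity.
Qed.

Lemma Gauss_seq_RtoC (x : R) (n : nat) :
  (forall k : nat, x + INR k <> 0) -> Gauss_seq x n = Gauss_seq_real x n.
Proof.
  intros H. unfold Gauss_seq, Gauss_seq_real.
  assert (Hp : prod_f_R0 (fun k => x + INR k) n <> 0).
  { clear - H. induction n; [exact (H O)|].
    apply Rmult_integral_contrapositive; split; [exact IHn|exact (H (S n))]. }
  rewrite Cpoch_RtoC, <- RtoC_mult.
  rewrite Cexp_RtoC, <- RtoC_mult, <- RtoC_div by exact Hp. reflexivity.
Qed.

(** For [x > 0] the terms of Gauss' sequence are nonnegative reals, which gives only [0 <= g];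
    strictness comes from the nonvanishing of the limit. *)
Lemma CGamma_real (x : R) :
  (forall k : nat, x + INR k <> 0) ->
  exists g : R, CGamma x = g /\ g <> 0 /\ (0 < x -> 0 < g).
Proof.
  intros H.
  destruct (CGamma_conv x) as [Hnz [H1 H2]].
  { intros k E. rewrite <- RtoC_plus in E. apply RtoC_inj in E. now apply (H k). }
  assert (Him : Im (CGamma x) = 0).
  { apply is_lim_seq_ext with (v := fun _ => 0) in H2.
    - apply is_lim_seq_unique in H2. rewrite Lim_seq_const in H2. now injection H2.
    - intros n. rewrite Gauss_seq_RtoC by exact H. reflexivity. }
  assert (E : CGamma x = Re (CGamma x)).
  { apply injective_projections; [reflexivity|exact Him]. }
  exists (Re (CGamma x)). split; [exact E|split].
  - intros E0. apply Hnz. now rewrite E, E0.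
  - intros Hx.
    assert (Hge : 0 <= Re (CGamma x)).
    { apply (is_lim_seq_le (fun _ => 0) (fun n => Re (Gauss_seq x n)) 0 (Re (CGamma x)));
        [|apply is_lim_seq_const|exact H1].
      intros n. rewrite Gauss_seq_RtoC by exact H. simpl. unfold Gauss_seq_real.
      apply Rmult_le_pos.
      - apply Rmult_le_pos; [apply pos_INR|apply Rlt_le, exp_pos].
      - apply Rlt_le, Rinv_0_lt_compat.
        clear - Hx. induction n; cbn -[INR].
        + simpl. lra.
        + apply Rmult_lt_0_compat; [exact IHn|]. assert (H := pos_INR (S n)). lra. }
    destruct Hge as [Hlt|E0]; [assumption|].
    exfalso. apply Hnz. now rewrite E, <- E0.
Qed.

(** The only fact about the branch that is needed: [m_hat] depends on the root through its square
    alone. The sign in [Csqrt] makes twice the product of the two components equal to [Im w]. *)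
Lemma Csqrt_sqr (w : C) : (Csqrt w * Csqrt w = w)%C.
Proof.
  assert (Hr := re_le_Cmod w). apply Rabs_le_between in Hr.
  assert (HC := Cmod2_alt w).
  unfold Csqrt.
  set (r := Cmod w) in *. destruct w as [x y]. unfold Re, Im in *. simpl fst in *. simpl snd in *.
  assert (H1 := sqrt_sqrt ((r + x) / 2) ltac:(lra)).
  assert (H2 := sqrt_sqrt ((r - x) / 2) ltac:(lra)).
  assert (H3 : 2 * (sqrt ((r + x) / 2) * sqrt ((r - x) / 2)) = Rabs y).
  { rewrite <- sqrt_mult by lra.
    replace ((r + x) / 2 * ((r - x) / 2)) with (Rsqr (y / 2)) by (unfold Rsqr; nra).
    rewrite sqrt_Rsqr_abs. unfold Rdiv. rewrite Rabs_mult, (Rabs_pos_eq (/ 2)) by lra. field. }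
  set (A := sqrt ((r + x) / 2)) in *. set (B := sqrt ((r - x) / 2)) in *.
  apply injective_projections; simpl; destruct (Rle_dec 0 y) as [Hy|Hy].
  - nra.
  - nra.
  - rewrite (Rabs_pos_eq y) in H3 by lra. lra.
  - rewrite (Rabs_left y) in H3 by lra. lra.
Qed.

(** * Product representation of m_hat *)

Definition sq (c : R) (k : nat) : R := (c + INR k) ^ 2.

Definition Gfactor (c d : R) (w : C) (k : nat) : C :=
  ((sq d k - w) / (sq c k - w))%C.

Definition Gn (c d : R) (w : C) (n : nat) : C :=
  (exp (2 * (c - d) * ln (INR n)) * Cprod (Gfactor c d w) (S n))%C.

Definition Gquot (c d : R) (t : C) : C :=
  (CGamma (c + t) * CGamma (c - t) / (CGamma (d + t) * CGamma (d - t)))%C.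

Lemma RtoC_minus_neq_0 (x : R) (w : C) : Im w <> 0 -> (x - w)%C <> 0.
Proof.
  intros H E. apply H. apply (f_equal Im) in E. simpl in E. unfold Im in *. lra.
Qed.

Lemma Gfactor_neq_0 (c d : R) (w : C) (k : nat) : Im w <> 0 -> Gfactor c d w k <> 0.
Proof.
  intros H. apply Cmult_neq_0; [|apply Cinv_neq_0]; now apply RtoC_minus_neq_0.
Qed.

(** Difference of squares, factor by factor. [Cpoch _ n] has [n + 1] factors, hence [S n] on the
    right. *)
Lemma Cpoch_sqr (c : R) (t : C) (n : nat) :
  (Cpoch (c + t) n * Cpoch (c - t) n)%C = Cprod (fun k => sq c k - t * t)%C (S n).
Proof.
  assert (Hf : forall k, ((c + t + INR k) * (c - t + INR k))%C = (sq c k - t * t)%C).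
  { intros k. unfold sq. rewrite RtoC_pow, RtoC_plus. ring. }
  induction n.
  - specialize (Hf O). simpl. rewrite <- Hf. simpl INR. ring.
  - change (Cprod (fun k => sq c k - t * t)%C (S (S n)))
      with (Cprod (fun k => sq c k - t * t)%C (S n) * (sq c (S n) - t * t))%C.
    rewrite <- IHn, <- Hf.
    change (Cpoch (c + t) (S n)) with (Cpoch (c + t) n * (c + t + INR (S n)))%C.
    change (Cpoch (c - t) (S n)) with (Cpoch (c - t) n * (c - t + INR (S n)))%C.
    ring.
Qed.

Lemma nonreal_not_pole (c : R) (t : C) :
  Im (t * t) <> 0 -> forall k : nat, (c + t + INR k)%C <> 0 /\ (c - t + INR k)%C <> 0.
Proof.
  intros H k.
  assert (Hi : Im t <> 0).
  { intros E. apply H. rewrite im_mult, E. ring. }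
  split; intros E; apply (f_equal Im) in E; simpl in E; unfold Im in *; lra.
Qed.

Lemma Cinv_mult (z w : C) : z <> 0 -> w <> 0 -> (/ (z * w))%C = (/ z * / w)%C.
Proof. intros. field. now split. Qed.

Lemma Cprod_inv (f : nat -> C) (n : nat) :
  (forall k, (k < n)%nat -> f k <> 0) -> Cprod (fun k => / f k)%C n = (/ Cprod f n)%C.
Proof.
  induction n; intros H; simpl; [field; exact C1_nz|].
  rewrite IHn by auto. symmetry. apply Cinv_mult; [|auto]. apply Cprod_neq_0; auto.
Qed.

Lemma Gauss_seq_quotient (c d : R) (t : C) (n : nat) :
  Im (t * t) <> 0 ->
  (Gauss_seq (c + t) n * Gauss_seq (c - t) n / (Gauss_seq (d + t) n * Gauss_seq (d - t) n))%C
  = Gn c d (t * t) n.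
Proof.
  intros H.
  assert (Pc := Cpoch_sqr c t n). assert (Pd := Cpoch_sqr d t n).
  assert (N1 := Cpoch_neq_0 (c + t) n (fun k => proj1 (nonreal_not_pole c t H k))).
  assert (N2 := Cpoch_neq_0 (c - t) n (fun k => proj2 (nonreal_not_pole c t H k))).
  assert (N3 := Cpoch_neq_0 (d + t) n (fun k => proj1 (nonreal_not_pole d t H k))).
  assert (N4 := Cpoch_neq_0 (d - t) n (fun k => proj2 (nonreal_not_pole d t H k))).
  set (L := ln (INR n)).
  assert (E : forall x : R, (Cexp ((x + t) * L) * Cexp ((x - t) * L))%C = exp (2 * x * L)).
  { intros x. rewrite <- Cexp_plus, <- Cexp_RtoC. f_equal.
    rewrite !RtoC_mult. ring. }
  unfold Gn, Gfactor, Cdiv. rewrite Cprod_mult, Cprod_inv.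
  2:{ intros k _. now apply RtoC_minus_neq_0. }
  rewrite <- Pc, <- Pd.
  fold L. replace (2 * (c - d) * L) with (2 * c * L + - (2 * d * L)) by ring.
  rewrite exp_plus, exp_Ropp, RtoC_mult, RtoC_inv, <- !E
    by (assert (Hp := exp_pos (2 * d * L)); lra).
  unfold Gauss_seq. fold L.
  assert (N5 : RtoC (INR (fact n)) <> 0).
  { intros E0. apply RtoC_inj in E0. now apply (INR_fact_neq_0 n). }
  assert (E1 := Cexp_neq_0 ((d + t) * L)). assert (E2 := Cexp_neq_0 ((d - t) * L)).
  field. repeat split; assumption.
Qed.

Lemma Gquot_conv (c d : R) (t : C) :
  Im (t * t) <> 0 -> Gquot c d t <> 0 /\ Cconv (Gn c d (t * t)) (Gquot c d t).
Proof.
  intros H.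
  destruct (CGamma_conv (c + t) (fun k => proj1 (nonreal_not_pole c t H k))) as [N1 C1].
  destruct (CGamma_conv (c - t) (fun k => proj2 (nonreal_not_pole c t H k))) as [N2 C2].
  destruct (CGamma_conv (d + t) (fun k => proj1 (nonreal_not_pole d t H k))) as [N3 C3].
  destruct (CGamma_conv (d - t) (fun k => proj2 (nonreal_not_pole d t H k))) as [N4 C4].
  assert (N34 := Cmult_neq_0 _ _ N3 N4).
  split.
  - apply Cmult_neq_0; [now apply Cmult_neq_0|now apply Cinv_neq_0].
  - apply Cconv_ext with (2 := Cconv_div _ _ _ _ N34 (Cconv_mult _ _ _ _ C1 C2)
                                 (Cconv_mult _ _ _ _ C3 C4)).
    intros n. now apply Gauss_seq_quotient.
Qed.

(** [K] is the prefactor of [m_hat]; since [b] is not an integer, [1 - b] and [1 + b] avoid the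
    poles of Gamma. For [-1 < b < 1] both are positive, so the sign of [K] is opposite to that of
    [b]. *)
Lemma m_hat_limit (a b : R) :
  (forall k : Z, b <> IZR k) ->
  exists K : R, K <> 0 /\ (-1 < b < 1 -> K * b < 0) /\
    forall z : C, Im z <> 0 -> exists L : C, L <> 0 /\
      Cconv (Gn ((1 + a + b) / 2) ((1 + a - b) / 2) (RtoC (((1 + a + b) / 2) ^ 2) + z)%C) L /\
      m_hat a b z = (K * L)%C.
Proof.
  intros Hb.
  destruct (CGamma_real (1 - b)) as [g1 [E1 [N1 P1]]].
  { intros k E. apply (Hb (1 + Z.of_nat k)%Z). rewrite plus_IZR, <- INR_IZR_INZ. lra. }
  destruct (CGamma_real (1 + b)) as [g2 [E2 [N2 P2]]].
  { intros k E. apply (Hb (- (1 + Z.of_nat k))%Z).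
    rewrite opp_IZR, plus_IZR, <- INR_IZR_INZ. lra. }
  set (p := Rpower 2 (1 + a + b)).
  assert (Hp : 0 < p) by apply exp_pos.
  assert (Hb0 : b <> 0) by apply (Hb 0%Z).
  assert (Hd : p * b * g2 <> 0) by (repeat apply Rmult_integral_contrapositive_currified; lra).
  exists (- g1 / (p * b * g2)). split; [|split].
  - intros E. apply N1. apply (f_equal (fun x => - x * (p * b * g2))) in E.
    replace (- (- g1 / (p * b * g2)) * (p * b * g2)) with g1 in E by (field; repeat split; lra). lra.
  - intros Hb1. specialize (P1 ltac:(lra)). specialize (P2 ltac:(lra)).
    replace (- g1 / (p * b * g2) * b) with (- (g1 / (p * g2))) by (field; lra).
    assert (0 < g1 / (p * g2)) by (apply Rdiv_lt_0_compat; nra). lra.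
  - intros z Hz.
    set (t := (Csqrt (RtoC ((1 + a + b) ^ 2) + 4 * z) / 2)%C).
    assert (N0 : RtoC 2 <> 0) by (intros E; apply RtoC_inj in E; lra).
    assert (Ht : (t * t = RtoC (((1 + a + b) / 2) ^ 2) + z)%C).
    { replace (t * t)%C with (Csqrt (RtoC ((1 + a + b) ^ 2) + 4 * z) *
        Csqrt (RtoC ((1 + a + b) ^ 2) + 4 * z) / 4)%C
        by (unfold t; field; intros E; apply RtoC_inj in E; lra).
      rewrite Csqrt_sqr.
      replace (RtoC ((1 + a + b) ^ 2)) with (4 * RtoC (((1 + a + b) / 2) ^ 2))%C.
      - field.
      - rewrite <- RtoC_mult. f_equal. field. }
    assert (Hi : Im (t * t) <> 0).
    { rewrite Ht, im_plus, im_RtoC. lra. }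
    destruct (Gquot_conv ((1 + a + b) / 2) ((1 + a - b) / 2) t Hi) as [HN HC].
    rewrite Ht in HC.
    exists (Gquot ((1 + a + b) / 2) ((1 + a - b) / 2) t).
    split; [exact HN|split; [exact HC|]].
    unfold m_hat, sigma_ab, Gquot. cbv zeta. rewrite E1, E2. fold p.
    assert (A1 : forall x : R, ((x + Csqrt (RtoC ((1 + a + b) ^ 2) + 4 * z)) / 2)%C
                  = (RtoC (x / 2) + t)%C).
    { intros x. rewrite RtoC_div by lra. unfold t. now field. }
    assert (A2 : forall x : R, ((x - Csqrt (RtoC ((1 + a + b) ^ 2) + 4 * z)) / 2)%C
                  = (RtoC (x / 2) - t)%C).
    { intros x. rewrite RtoC_div by lra. unfold t. now field. }
    rewrite !A1, !A2.
    f_equal. rewrite <- RtoC_opp, <- RtoC_mult, <- RtoC_div by exact Hd. reflexivity.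
Qed.

(** * Local expansion *)

(** At [h = 0] this is the logarithmic derivative of the factor [Gfactor c d w k] in [w]; for
    general [h] it is the difference quotient that makes [Gfactor_shift] exact. *)
Definition kern (c d : R) (w h : C) (k : nat) : C :=
  ((sq d k - sq c k) / ((sq d k - w) * (sq c k - w - h)))%C.

Lemma sq_growth (c u : R) :
  exists N : nat, forall k, (N <= k)%nat -> / 16 * (INR k + 1) ^ 2 <= sq c k - u.
Proof.
  assert (Hc := Rabs_pos c). assert (Hu := Rabs_pos u).
  (* Beyond this index [(c + k)^2 >= 9/16 k^2] and [u <= k^2 / 4], which leaves [5/16 k^2]. The
     weaker [/ 16] absorbs the shift to [k + 1] and does not depend on [c] or [u]. *)
  destruct (nfloor_ex (4 * Rabs c + 4 * Rabs u + 4) ltac:(lra)) as [N [_ HN]].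
  exists (S N). intros k Hk. apply le_INR in Hk. rewrite S_INR in Hk.
  unfold sq. set (x := INR k) in *.
  assert (H1 := Rle_abs u). assert (H2 := Rle_abs (- c)). rewrite Rabs_Ropp in H2.
  assert (H3 : 3 / 4 * x <= c + x) by lra.
  assert (H4 : 9 / 16 * x ^ 2 <= (c + x) ^ 2) by nra.
  assert (H5 : 4 * Rabs u <= x ^ 2) by nra.
  nra.
Qed.

(** Large [k] are handled by quadratic growth, the finitely many others by [|Im w|]. *)
Lemma sq_far_nonreal (c : R) (w : C) :
  Im w <> 0 -> exists delta, 0 < delta /\
    forall k, delta * INR (S k) ^ 2 <= Cmod (sq c k - w).
Proof.
  intros Hw.
  destruct (sq_growth c (Cmod w)) as [N HN].
  set (y := Rabs (Im w)). assert (Hy : 0 < y) by now apply Rabs_pos_lt.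
  assert (HN0 : 0 < (INR N + 1) ^ 2) by (assert (H := pos_INR N); nra).
  assert (Hq : 0 < y / (INR N + 1) ^ 2) by now apply Rdiv_lt_0_compat.
  exists (Rmin (/ 16) (y / (INR N + 1) ^ 2)). split; [apply Rmin_pos; lra|].
  intros k. rewrite S_INR.
  assert (Hk0 := pos_INR k).
  assert (Hk2 : 0 <= (INR k + 1) ^ 2) by nra.
  destruct (le_lt_dec N k) as [Hk|Hk].
  - apply Rle_trans with (/ 16 * (INR k + 1) ^ 2).
    { apply Rmult_le_compat_r; [assumption|apply Rmin_l]. }
    specialize (HN k Hk).
    assert (Ht := Cmod_triangle (sq c k - w) w).
    replace (sq c k - w + w)%C with (RtoC (sq c k)) in Ht by ring.
    rewrite Cmod_R in Ht. assert (H := Rle_abs (sq c k)). lra.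
  - apply Rle_trans with y.
    + apply Rle_trans with (y / (INR N + 1) ^ 2 * (INR k + 1) ^ 2).
      { apply Rmult_le_compat_r; [assumption|apply Rmin_r]. }
      apply lt_INR in Hk.
      apply (Rmult_le_reg_r ((INR N + 1) ^ 2)); [assumption|].
      replace (y / (INR N + 1) ^ 2 * (INR k + 1) ^ 2 * (INR N + 1) ^ 2)
        with (y * (INR k + 1) ^ 2) by (field; lra).
      apply Rmult_le_compat_l; [lra|]. apply pow_incr; lra.
    + assert (H := im_le_Cmod (sq c k - w)%C).
      replace (Im (sq c k - w)%C) with (- Im w) in H by (unfold Im; simpl; ring).
      now rewrite Rabs_Ropp in H.
Qed.

(** The offset [n0] serves two uses: all indices at a nonreal [w], and only the tail at a real
    point, where early factors may vanish. [S j] keeps the bound positive at [j = 0]. *)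
Definition far_from (c : R) (n0 : nat) (w : C) (delta : R) : Prop :=
  forall j, delta * INR (S j) ^ 2 <= Cmod (sq c (n0 + j) - w).

Lemma far_from_neq (c : R) (n0 : nat) (w h : C) (delta : R) :
  0 < delta -> far_from c n0 w delta -> Cmod h <= delta / 2 ->
  forall j, delta / 2 * INR (S j) ^ 2 <= Cmod (sq c (n0 + j) - w - h) /\
            (sq c (n0 + j) - w - h)%C <> 0.
Proof.
  intros Hd H Hh j. specialize (H j).
  assert (Hj : 1 <= INR (S j) ^ 2).
  { rewrite S_INR. assert (Hj := pos_INR j). nra. }
  assert (Ht := Cmod_triangle (sq c (n0 + j) - w - h) h).
  replace (sq c (n0 + j) - w - h + h)%C with (sq c (n0 + j) - w)%C in Ht by ring.
  assert (Hg : delta / 2 * INR (S j) ^ 2 <= Cmod (sq c (n0 + j) - w - h)) by nra.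
  split; [exact Hg|]. apply Cmod_gt_0. nra.
Qed.

(** The numerator is a difference of squares, hence linear in the index, and the denominator is of
    degree four. The resulting decay [j^-3] is weakened to the telescoping form. One [A] serves all
    [h] because a shift by [delta / 2] costs at most half of the distance. *)
Lemma kern_bound (c d : R) (n0 : nat) (w : C) (delta : R) :
  0 < delta -> far_from c n0 w delta -> far_from d n0 w delta ->
  exists A, 0 <= A /\ forall h, Cmod h <= delta / 2 -> forall j,
    Cmod (kern c d w h (n0 + j)) <= A * / (INR (S j) * INR (S (S j))).
Proof.
  intros Hd Hc Hdd.
  set (A0 := Rabs (d - c) * (Rabs (d + c) + 2 * INR n0 + 2)).
  assert (HA0 : 0 <= A0).
  { apply Rmult_le_pos; [apply Rabs_pos|].
    assert (H := Rabs_pos (d + c)). assert (H' := pos_INR n0). lra. }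
  exists (4 * A0 / delta ^ 2).
  assert (Hd2 : 0 < delta ^ 2) by nra.
  split; [apply Rdiv_le_0_compat; lra|].
  intros h Hh j.
  destruct (far_from_neq c n0 w h delta Hd Hc Hh j) as [B1 N1].
  destruct (far_from_neq d n0 w 0 delta Hd Hdd ltac:(rewrite Cmod_0; lra) j) as [_ N2].
  specialize (Hdd j).
  replace (sq d (n0 + j) - w - 0)%C with (sq d (n0 + j) - w)%C in N2 by ring.
  unfold kern. rewrite Cmod_div by now apply Cmult_neq_0.
  rewrite Cmod_mult, <- RtoC_minus, Cmod_R.
  rewrite (S_INR (S j)). set (x := INR (S j)) in *.
  assert (Hx : 1 <= x) by (unfold x; rewrite S_INR; assert (H := pos_INR j); lra).
  assert (Hx2 : 1 <= x ^ 2) by nra.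
  assert (Hnum : Rabs (sq d (n0 + j) - sq c (n0 + j)) <= A0 * x).
  { unfold sq, A0. rewrite plus_INR.
    replace ((d + (INR n0 + INR j)) ^ 2 - (c + (INR n0 + INR j)) ^ 2)
      with ((d - c) * (d + c + 2 * INR n0 + 2 * INR j)) by ring.
    rewrite Rabs_mult, Rmult_assoc. apply Rmult_le_compat_l; [apply Rabs_pos|].
    assert (Hp := Rabs_pos (d + c)). assert (Hp' := pos_INR n0). assert (Hj := pos_INR j).
    replace (d + c + 2 * INR n0 + 2 * INR j) with ((d + c) + (2 * INR n0 + 2 * INR j)) by ring.
    eapply Rle_trans; [apply Rabs_triang|].
    rewrite (Rabs_pos_eq (2 * INR n0 + 2 * INR j)) by lra.
    assert (x = INR j + 1) by (unfold x; apply S_INR). nra. }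
  set (P := Cmod (sq c (n0 + j) - w - h)) in *. set (Q := Cmod (sq d (n0 + j) - w)) in *.
  assert (HPQ : delta ^ 2 / 2 * (x ^ 2 * x ^ 2) <= Q * P).
  { replace (delta ^ 2 / 2 * (x ^ 2 * x ^ 2)) with ((delta * x ^ 2) * (delta / 2 * x ^ 2)) by field.
    apply Rmult_le_compat; nra. }
  assert (HPQ0 : 0 < Q * P).
  { eapply Rlt_le_trans; [|exact HPQ]. apply Rmult_lt_0_compat; nra. }
  apply (Rmult_le_reg_r (Q * P)); [exact HPQ0|].
  unfold Rdiv at 1. rewrite Rmult_assoc, Rinv_l, Rmult_1_r by lra.
  eapply Rle_trans; [exact Hnum|].
  apply Rle_trans with (4 * A0 / delta ^ 2 * / (x * (x + 1)) * (delta ^ 2 / 2 * (x ^ 2 * x ^ 2))).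
  - replace (4 * A0 / delta ^ 2 * / (x * (x + 1)) * (delta ^ 2 / 2 * (x ^ 2 * x ^ 2)))
      with (A0 * (2 * x ^ 3 / (x + 1))) by (field; lra).
    apply Rmult_le_compat_l; [assumption|].
    apply (Rmult_le_reg_r (x + 1)); [lra|].
    replace (2 * x ^ 3 / (x + 1) * (x + 1)) with (2 * x ^ 3) by (field; lra). nra.
  - apply Rmult_le_compat_l; [|exact HPQ].
    apply Rmult_le_pos; [apply Rdiv_le_0_compat; lra|].
    apply Rlt_le, Rinv_0_lt_compat. nra.
Qed.

Lemma Gfactor_shift (c d : R) (w h : C) (k : nat) :
  (sq c k - w)%C <> 0 -> (sq d k - w)%C <> 0 -> (sq c k - w - h)%C <> 0 ->
  Gfactor c d (w + h) k = (Gfactor c d w k * (1 + h * kern c d w h k))%C.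
Proof.
  intros H1 H2 H3. unfold Gfactor, kern. field.
  repeat split; assumption.
Qed.

Lemma Csum_scal_minus (f g : nat -> C) (a : C) (n : nat) :
  (Csum (fun k => a * f k) n - a * Csum g n)%C = (a * Csum (fun k => f k - g k) n)%C.
Proof.
  induction n; simpl; [ring|].
  replace (Csum (fun k => a * f k) n + a * f n - a * (Csum g n + g n))%C
    with ((Csum (fun k => a * f k) n - a * Csum g n) + a * (f n - g n))%C by ring.
  rewrite IHn. ring.
Qed.

Lemma Rsum_recip_le (A : R) (n : nat) :
  0 <= A -> Rsum (fun j => A * / (INR (S j) * INR (S (S j)))) n <= A.
Proof.
  intros HA. eapply Rle_trans; [apply Rsum_recip_bound; intros k; apply Rle_refl|].
  assert (0 < / INR (S n)) by (apply Rinv_0_lt_compat, lt_0_INR; lia). nra.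
Qed.

(* Locally G_n(w+h)/G_n(w) is a product of factors 1 + h e_k with e_k = O(k^-3) uniformly in h;
   this gives the derivative without any complex function theory. *)
Lemma Gn_limit_expansion (c d : R) (F : C -> C) (w : C) :
  Im w > 0 -> (forall v, Im v > 0 -> Cconv (Gn c d v) (F v)) ->
  exists (D : C) (B delta : R), 0 < delta /\ 0 <= B /\
    forall h, Cmod h < delta -> Cmod (F (w + h)%C - F w - h * D) <= B * Cmod h ^ 2.
Proof.
  intros Hw HF.
  destruct (sq_far_nonreal c w ltac:(lra)) as [d1 [Hd1 Hf1]].
  destruct (sq_far_nonreal d w ltac:(lra)) as [d2 [Hd2 Hf2]].
  set (dl := Rmin d1 d2).
  assert (Hdl : 0 < dl) by now apply Rmin_pos.
  assert (Hsq : forall j, 0 <= INR (S j) ^ 2) by (intros j; apply pow2_ge_0).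
  assert (Fc : far_from c 0 w dl).
  { intros j. eapply Rle_trans; [|apply Hf1].
    apply Rmult_le_compat_r; [apply Hsq|apply Rmin_l]. }
  assert (Fd : far_from d 0 w dl).
  { intros j. eapply Rle_trans; [|apply Hf2].
    apply Rmult_le_compat_r; [apply Hsq|apply Rmin_r]. }
  destruct (kern_bound c d 0 w dl Hdl Fc Fd) as [A [HA HK]]. simpl plus in HK.
  assert (Hz : Cmod 0 <= dl / 2) by (rewrite Cmod_0; lra).
  destruct (Cconv_of_summable_steps (fun n => Csum (kern c d w 0) (S n)) A 1) as [E HE].
  { lia. }
  { intros n Hn. simpl Csum.
    replace (Csum (kern c d w 0) n + kern c d w 0 n + kern c d w 0 (S n) -
      (Csum (kern c d w 0) n + kern c d w 0 n))%C with (kern c d w 0 (S n)) by ring.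
    eapply Rle_trans; [apply (HK 0%C Hz (S n))|].
    apply Rmult_le_compat_l; [assumption|].
    assert (Hn' : 1 <= INR n) by (apply (le_INR 1), Hn).
    apply Rinv_le_contravar; rewrite !S_INR; nra. }
  set (A' := 1 + A).
  assert (HA' : 0 < A') by (unfold A'; lra).
  (* [E] is the sum of the logarithmic derivatives. In the error constant, [Cmod (F w) + 1]
     eventually bounds the partial products at [w], [A ^ 2] comes from expanding the product, and
     [2 * A / dl] from the variation of [kern] with [h]. The three radii allow [kern_bound], make
     the sum of the perturbations at most 1, and keep [w + h] in the upper half-plane. *)
  exists (F w * E)%C, ((Cmod (F w) + 1) * (A ^ 2 + 2 * A / dl)),
    (Rmin (dl / 2) (Rmin (/ A') (Im w))).
  split; [repeat apply Rmin_pos; try lra; now apply Rinv_0_lt_compat|].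
  assert (HFw := Cmod_ge_0 (F w)).
  assert (HAd : 0 <= 2 * A / dl) by (apply Rdiv_le_0_compat; lra).
  split; [nra|].
  intros h Hh.
  assert (Hh1 : Cmod h <= dl / 2).
  { apply Rlt_le. eapply Rlt_le_trans; [exact Hh|apply Rmin_l]. }
  assert (Hh2 : Cmod h * A' <= 1).
  { apply Rle_trans with (/ A' * A'); [|rewrite Rinv_l; lra].
    apply Rmult_le_compat_r; [lra|]. apply Rlt_le. eapply Rlt_le_trans; [exact Hh|].
    eapply Rle_trans; [apply Rmin_r|apply Rmin_l]. }
  assert (Hh3 : Im (w + h) > 0).
  { assert (Cmod h < Im w).
    { eapply Rlt_le_trans; [exact Hh|]. eapply Rle_trans; [apply Rmin_r|apply Rmin_r]. }
    assert (H1 := im_le_Cmod h). apply Rabs_le_between in H1. rewrite im_plus. lra. }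
  assert (Hh0 := Cmod_ge_0 h).
  assert (Hfac : forall n, Gn c d (w + h) n =
     (Gn c d w n * Cprod (fun k => 1 + h * kern c d w h k) (S n))%C).
  { intros n. unfold Gn. rewrite <- Cmult_assoc, <- Cprod_mult. f_equal.
    apply Cprod_ext. intros k _.
    destruct (far_from_neq c 0 w h dl Hdl Fc Hh1 k) as [_ N1].
    apply Gfactor_shift; [apply RtoC_minus_neq_0; lra|apply RtoC_minus_neq_0; lra|exact N1]. }
  set (t := fun j => Cmod h * (A * / (INR (S j) * INR (S (S j))))).
  assert (Ht : forall j, Cmod (h * kern c d w h j) <= t j).
  { intros j. rewrite Cmod_mult. apply Rmult_le_compat_l; [assumption|]. now apply HK. }
  assert (HT : forall n, Rsum t n <= Cmod h * A).
  { intros n. rewrite (Rsum_ext t (fun j => (Cmod h * A) * / (INR (S j) * INR (S (S j))))).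
    - apply Rsum_recip_le. nra.
    - intros k _. unfold t. ring. }
  assert (HT0 : forall n, 0 <= Rsum t n).
  { intros n. eapply Rle_trans; [|apply (Cmod_Csum_le _ t n Ht)]. apply Cmod_ge_0. }
  assert (HTA : Cmod h * A <= 1) by (unfold A' in Hh2; nra).
  assert (Hexp : forall n, Cmod (Cprod (fun k => 1 + h * kern c d w h k)%C n - 1
                   - h * Csum (kern c d w 0) n) <= (A ^ 2 + 2 * A / dl) * Cmod h ^ 2).
  { intros n.
    assert (H1 := Cprod_one_plus _ t n Ht (Rle_trans _ _ _ (HT n) HTA)).
    set (p := Cprod _ n) in *.
    replace (p - 1 - h * Csum (kern c d w 0) n)%C
      with ((p - 1 - Csum (fun k => h * kern c d w h k) n) +
            (Csum (fun k => h * kern c d w h k) n - h * Csum (kern c d w 0) n))%C by ring.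
    eapply Rle_trans; [apply Cmod_triangle|].
    rewrite Csum_scal_minus, Cmod_mult.
    assert (H2 : Cmod (Csum (fun k => kern c d w h k - kern c d w 0 k)%C n) <= 2 * A / dl * Cmod h).
    { eapply Rle_trans.
      - apply Cmod_Csum_le with
          (t := fun j => (2 * A / dl * Cmod h) * / (INR (S j) * INR (S (S j)))).
        intros k.
        destruct (far_from_neq c 0 w h dl Hdl Fc Hh1 k) as [_ N1]. simpl plus in N1.
        assert (N2 : (sq c k - w)%C <> 0) by (apply RtoC_minus_neq_0; lra).
        assert (N3 : (sq d k - w)%C <> 0) by (apply RtoC_minus_neq_0; lra).
        replace (kern c d w h k - kern c d w 0 k)%C with (kern c d w h k * (h / (sq c k - w)))%C.
        2:{ unfold kern. field. repeat split; assumption. }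
        rewrite Cmod_mult, Cmod_div by assumption.
        specialize (HK h Hh1 k). specialize (Fc k). simpl plus in Fc.
        assert (Hm : dl <= Cmod (sq c k - w)).
        { assert (Hx1 : 1 <= INR (S k)) by (apply (le_INR 1); lia).
          assert (Hx2 : 1 <= INR (S k) ^ 2) by nra.
          eapply Rle_trans; [|exact Fc]. clear - Hdl Hx2. nra. }
        replace (2 * A / dl * Cmod h * / (INR (S k) * INR (S (S k))))
          with ((A * / (INR (S k) * INR (S (S k)))) * (2 * (Cmod h / dl))).
        2:{ field. split; [|split; [|lra]]; apply not_0_INR; lia. }
        apply Rmult_le_compat; [apply Cmod_ge_0| |assumption|].
        + apply Rdiv_le_0_compat; lra.
        + apply Rle_trans with (Cmod h / dl).
          * apply Rmult_le_compat_l; [assumption|]. apply Rinv_le_contravar; lra.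
          * assert (0 <= Cmod h / dl) by (apply Rdiv_le_0_compat; lra). lra.
      - apply Rsum_recip_le. nra. }
    assert (H3 := HT n). assert (H4 := HT0 n).
    assert (Rsum t n ^ 2 <= (Cmod h * A) ^ 2) by (apply pow_incr; lra). nra. }
  apply Cmod_le_lim with (u := fun n =>
    (Gn c d (w + h) n - Gn c d w n - h * (Gn c d w n * Csum (kern c d w 0) (S n)))%C).
  - assert (Hev : eventually (fun n => Cmod (Gn c d w n) < Cmod (F w) + 1)).
    { assert (H := Cconv_Cmod _ _ (HF w Hw)).
      apply is_lim_seq_spec in H. destruct (H (mkposreal 1 Rlt_0_1)) as [N HN].
      exists N. intros n Hn. specialize (HN n Hn). simpl in HN.
      apply Rabs_def2 in HN. lra. }
    destruct Hev as [N HN]. exists N. intros n Hn. specialize (HN n Hn).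
    rewrite Hfac.
    set (p := Cprod _ (S n)). specialize (Hexp (S n)). fold p in Hexp.
    replace (Gn c d w n * p - Gn c d w n - h * (Gn c d w n * Csum (kern c d w 0) (S n)))%C
      with (Gn c d w n * (p - 1 - h * Csum (kern c d w 0) (S n)))%C by ring.
    rewrite Cmod_mult, Rmult_assoc.
    apply Rmult_le_compat; [apply Cmod_ge_0|apply Cmod_ge_0|lra|exact Hexp].
  - assert (C1 := HF w Hw). assert (C2 := HF _ Hh3).
    unfold Cminus.
    apply Cconv_plus; [apply Cconv_plus; [exact C2|now apply Cconv_opp]|].
    apply Cconv_opp. apply Cconv_mult; [apply Cconv_const|].
    apply Cconv_mult; assumption.
Qed.

(** * Interlacing zeros and poles *)

(** A relation and not an argument function: angles add under multiplication with no reduction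
    modulo [2 PI], so total turning is remembered. *)
Definition polar (z : C) (a : R) : Prop :=
  exists r, 0 < r /\ z = (r * cos a, r * sin a).

Lemma polar_pos (x : R) : 0 < x -> polar x 0.
Proof.
  intros Hx. exists x. split; [assumption|].
  rewrite cos_0, sin_0. apply injective_projections; simpl; ring.
Qed.

Lemma polar_mult (z w : C) (a b : R) : polar z a -> polar w b -> polar (z * w) (a + b).
Proof.
  intros [r [Hr ->]] [s [Hs ->]]. exists (r * s). split; [now apply Rmult_lt_0_compat|].
  rewrite cos_plus, sin_plus. apply injective_projections; simpl; ring.
Qed.

Lemma polar_Cmod (z : C) (a : R) :
  polar z a -> 0 < Cmod z /\ z = (Cmod z * cos a, Cmod z * sin a).
Proof.
  intros [r [Hr ->]].
  assert (E : Cmod (r * cos a, r * sin a) = r).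
  { assert (H := Cmod2_alt (r * cos a, r * sin a)). unfold Re, Im in H; simpl fst in H; simpl snd in H.
    assert (H1 := sin2_cos2 a). unfold Rsqr in H1.
    assert (H0 := Cmod_ge_0 (r * cos a, r * sin a)).
    set (m := Cmod _) in *.
    assert (H2 : m ^ 2 = r ^ 2).
    { rewrite H. transitivity (r ^ 2 * (sin a * sin a + cos a * cos a)); [ring|].
      rewrite H1; ring. }
    nra. }
  rewrite E. now split.
Qed.

Lemma polar_neq_0 (z : C) (a : R) : polar z a -> z <> 0.
Proof. intros H. apply Cmod_gt_0. now apply (polar_Cmod z a). Qed.

Lemma polar_inv (z : C) (a : R) : polar z a -> polar (/ z) (- a).
Proof.
  intros H. assert (Hz := polar_neq_0 z a H). destruct H as [r [Hr E]].
  exists (/ r). split; [now apply Rinv_0_lt_compat|].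
  rewrite cos_neg, sin_neg.
  set (u := (/ r * cos a, / r * - sin a)).
  assert (Hu : (z * u)%C = 1).
  { assert (H1 := sin2_cos2 a). unfold Rsqr in H1.
    rewrite E. unfold u. apply injective_projections; simpl.
    - transitivity (r * / r * (sin a * sin a + cos a * cos a)); [ring|].
      rewrite H1. field. lra.
    - ring. }
  rewrite <- (Cmult_1_r (/ z)), <- Hu, Cmult_assoc, Cinv_l by assumption. ring.
Qed.

Lemma polar_div (z w : C) (a b : R) : polar z a -> polar w b -> polar (z / w) (a - b).
Proof. intros Hz Hw. apply polar_mult; [assumption|now apply polar_inv]. Qed.

Lemma polar_Cprod (f : nat -> C) (a : nat -> R) (n : nat) :
  (forall k, (k < n)%nat -> polar (f k) (a k)) -> polar (Cprod f n) (Rsum a n).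
Proof.
  induction n; intros H; simpl.
  - apply polar_pos, Rlt_0_1.
  - apply polar_mult; auto.
Qed.

(** For [Im w > 0] this is the argument of [q - w], which lies in the lower half-plane. The [atan]
    form covers both sides of [Re w] and makes monotonicity in [q] immediate. *)
Definition angle (w : C) (q : R) : R := - (PI / 2) + atan ((q - Re w) / Im w).

Lemma angle_bounds (w : C) (q : R) : - PI < angle w q < 0.
Proof.
  unfold angle. assert (H := atan_bound ((q - Re w) / Im w)). lra.
Qed.

Lemma angle_increasing (w : C) (p q : R) : 0 < Im w -> p < q -> angle w p < angle w q.
Proof.
  intros Hw H. unfold angle. apply Rplus_lt_compat_l, atan_increasing.
  apply Rmult_lt_compat_r; [now apply Rinv_0_lt_compat|lra].
Qed.

Lemma polar_angle (w : C) (q : R) : 0 < Im w -> polar (q - w) (angle w q).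
Proof.
  intros Hw. unfold angle.
  set (x := (q - Re w) / Im w).
  assert (Hs : 0 < sqrt (1 + x²)) by (apply sqrt_lt_R0; assert (H := Rle_0_sqr x); lra).
  exists (Im w * sqrt (1 + x²)). split; [now apply Rmult_lt_0_compat|].
  rewrite cos_plus, sin_plus, cos_neg, sin_neg, cos_PI2, sin_PI2, cos_atan, sin_atan.
  apply injective_projections; simpl.
  - transitivity (Im w * x); [unfold x, Re, Im in *; field; lra|field; lra].
  - unfold Im in *; field; lra.
Qed.

Lemma Gfactor_polar (c d : R) (w : C) (k : nat) :
  0 < Im w -> polar (Gfactor c d w k) (angle w (sq d k) - angle w (sq c k)).
Proof. intros Hw. apply polar_div; now apply polar_angle. Qed.

Lemma Gn_polar (c d : R) (w : C) (n : nat) :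
  0 < Im w ->
  polar (Gn c d w n) (Rsum (fun k => angle w (sq d k) - angle w (sq c k)) (S n)).
Proof.
  intros Hw. rewrite <- (Rplus_0_l (Rsum _ _)). apply polar_mult.
  - apply polar_pos, exp_pos.
  - apply polar_Cprod. intros k _. now apply Gfactor_polar.
Qed.

(** On [(- PI, 0)] the sine decreases and then increases, so its maximum over a closed subinterval
    sits at an endpoint. The uniform [s] is what survives the limit. *)
Lemma sin_le_on_negative_interval (A B : R) :
  - PI < A -> B < 0 ->
  exists s, 0 < s /\ forall x, A <= x <= B -> sin x <= - s.
Proof.
  intros HA HB. assert (HP := PI_RGT_0).
  destruct (Rle_lt_dec A B) as [HAB|HAB].
  2:{ exists 1. split; [lra|]. intros x Hx. lra. }
  assert (NA : sin A < 0) by (apply sin_lt_0_var; lra).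
  assert (NB : sin B < 0) by (apply sin_lt_0_var; lra).
  exists (Rmin (- sin A) (- sin B)). split; [apply Rmin_pos; lra|].
  intros x Hx.
  destruct (Rle_lt_dec x (- (PI / 2))).
  - assert (sin x <= sin A).
    { destruct (Req_dec x A) as [->|]; [lra|].
      assert (H0 : sin (- x - PI) <= sin (- A - PI)).
      { apply sin_incr_1; lra. }
      replace (- x - PI) with (- (x + PI)) in H0 by ring.
      replace (- A - PI) with (- (A + PI)) in H0 by ring.
      rewrite !sin_neg, !neg_sin in H0. lra. }
    assert (Hm := Rmin_l (- sin A) (- sin B)). lra.
  - assert (sin x <= sin B).
    { destruct (Rle_lt_dec B (PI / 2)); [apply sin_incr_1; lra|lra]. }
    assert (Hm := Rmin_r (- sin A) (- sin B)). lra.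
Qed.

(** Regroup the sum in two ways: as [a O - b m] plus the positive gaps [a (S k) - b k], and as
    [a O - b O] plus the negative terms that remain. *)
Lemma Rsum_interlaced (a b : nat -> R) (m : nat) :
  (forall k, a k < b k) -> (forall k, b k < a (S k)) ->
  a O - b m <= Rsum (fun k => a k - b k) (S m) <= a O - b O.
Proof.
  intros H1 H2. induction m.
  - simpl. lra.
  - specialize (H1 (S m)). specialize (H2 m). simpl Rsum in *. lra.
Qed.

(** The argument of each late partial product lies in [[a O, a O - b O]], inside [(- PI, 0)]. So
    [Im <= - s * Cmod] holds before the limit and hence after it, and [L <> 0] makes it strict. *)
Lemma Im_neg_of_interlacing (c d : R) (w L : C) (n0 : nat) :
  0 < Im w -> 
  (forall k, sq d (n0 + k) < sq c (n0 + k)) ->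
  (forall k, sq c (n0 + k) < sq d (n0 + S k)) ->
  Rsum (fun k => angle w (sq d k) - angle w (sq c k)) n0 = 0 ->
  L <> 0 -> Cconv (Gn c d w) L -> Im L < 0.
Proof.
  intros Hw H1 H2 H0 HL HC.
  set (a := fun k => angle w (sq d (n0 + k))).
  set (b := fun k => angle w (sq c (n0 + k))).
  assert (Hab : forall k, a k < b k) by (intros k; now apply angle_increasing).
  assert (Hba : forall k, b k < a (S k)) by (intros k; now apply angle_increasing).
  assert (HA : - PI < a O) by apply angle_bounds.
  destruct (sin_le_on_negative_interval (a O) (a O - b O)) as [s [Hs Hsin]];
    [assumption|specialize (Hab O); lra|].
  assert (HLp : 0 < Cmod L) by now apply Cmod_gt_0.
  assert (Hlim : Im L <= - s * Cmod L); [|nra].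
  apply (is_lim_seq_le_loc (fun n => Im (Gn c d w n)) (fun n => - s * Cmod (Gn c d w n))
           (Im L) (- s * Cmod L)).
  - exists n0. intros n Hn.
    destruct (polar_Cmod _ _ (Gn_polar c d w n Hw)) as [Hr E].
    rewrite (f_equal Im E : Im (Gn c d w n) = Cmod (Gn c d w n) * sin _).
    replace (S n) with (n0 + S (n - n0))%nat by lia.
    rewrite Rsum_add, H0, Rplus_0_l.
    change (fun k => angle w (sq d (n0 + k)) - angle w (sq c (n0 + k)))
      with (fun k => a k - b k).
    assert (HS := Rsum_interlaced a b (n - n0) Hab Hba).
    assert (Hb : b (n - n0)%nat < 0) by apply angle_bounds.
    specialize (Hsin (Rsum (fun k => a k - b k) (S (n - n0))) ltac:(lra)). nra.
  - exact (proj2 HC).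
  - apply is_lim_seq_mult'; [apply is_lim_seq_const|now apply Cconv_Cmod].
Qed.

(** Negative [beta] exchanges the roles of [c] and [d]; this reduces that case to the positive one
    at the price of a reciprocal. *)
Lemma Gn_swap (c d : R) (w : C) (n : nat) : Im w <> 0 -> Gn d c w n = (/ Gn c d w n)%C.
Proof.
  intros Hw. unfold Gn.
  assert (Hp := exp_pos (2 * (c - d) * ln (INR n))).
  rewrite Cinv_mult.
  - f_equal.
    + rewrite <- RtoC_inv by lra. rewrite <- exp_Ropp. f_equal. f_equal. ring.
    + rewrite <- Cprod_inv by (intros k _; now apply Gfactor_neq_0).
      apply Cprod_ext. intros k _. unfold Gfactor.
      assert (H1 := RtoC_minus_neq_0 (sq c k) w Hw).
      assert (H2 := RtoC_minus_neq_0 (sq d k) w Hw).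
      field. now split.
  - intros E. apply RtoC_inj in E. lra.
  - apply Cprod_neq_0. intros k _. now apply Gfactor_neq_0.
Qed.

Lemma Cconv_Gn_swap (c d : R) (w L : C) :
  Im w <> 0 -> L <> 0 -> Cconv (Gn c d w) L -> Cconv (Gn d c w) (/ L).
Proof.
  intros Hw HL H. apply Cconv_ext with (fun n => / Gn c d w n)%C.
  - intros n. symmetry. now apply Gn_swap.
  - now apply Cconv_inv.
Qed.

Lemma Im_inv_neg (z : C) : z <> 0 -> Im (/ z) < 0 <-> 0 < Im z.
Proof.
  intros Hz.
  assert (Hm : 0 < Re z ^ 2 + Im z ^ 2).
  { rewrite <- Cmod2_alt. apply pow_lt. now apply Cmod_gt_0. }
  assert (E : Im (/ z) = - Im z * / (Re z ^ 2 + Im z ^ 2)) by reflexivity.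
  assert (Hi := Rinv_0_lt_compat _ Hm). rewrite E.
  set (i := / (Re z ^ 2 + Im z ^ 2)) in *. split; intros H; nra.
Qed.

(** Interlacing is read off from [sq c k - sq d k = (c - d) (c + d + 2 k)] and [sq d (S k) - sq c k
    = (1 - (c - d)) (c + d + 2 k + 1)]. If [c + d = - n], it starts at index [n + 1], after the
    common factors. *)
Lemma Im_limit_neg (c d : R) (w L : C) :
  0 < c - d < 1 -> (0 < c + d \/ exists n : nat, c + d = - INR n) ->
  0 < Im w -> L <> 0 -> Cconv (Gn c d w) L -> Im L < 0.
Proof.
  intros Hcd Hs Hw HL HC.
  assert (D1 : forall k, 0 < c + d + 2 * INR k -> sq d k < sq c k).
  { intros k Hk. unfold sq. nra. }
  assert (D2 : forall k, 0 < c + d + 2 * INR k -> sq c k < sq d (S k)).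
  { intros k Hk. unfold sq. rewrite S_INR. nra. }
  destruct Hs as [Hs|[n Hn]].
  - apply (Im_neg_of_interlacing c d w L 0); try assumption; [| |reflexivity].
    + intros k. apply (D1 k). assert (H := pos_INR k). lra.
    + intros k. apply (D2 k). assert (H := pos_INR k). lra.
  - assert (Hp : forall k, 0 < c + d + 2 * INR (S n + k)).
    { intros k. rewrite plus_INR, S_INR. assert (H := pos_INR n). assert (H' := pos_INR k). lra. }
    apply (Im_neg_of_interlacing c d w L (S n)); try assumption.
    + intros k. apply D1, Hp.
    + intros k. replace (S n + S k)%nat with (S (S n + k)) by lia. apply D2, Hp.
    + (* (c + n - k)^2 = (d + k)^2: the first n+1 zeros and poles coincide *)
      rewrite Rsum_minus, <- (Rsum_rev (fun k => angle w (sq c k))).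
      rewrite (Rsum_ext (fun k => angle w (sq c (S n - 1 - k))) (fun k => angle w (sq d k))); [ring|].
      intros k Hk. f_equal. unfold sq. replace (S n - 1 - k)%nat with (n - k)%nat by lia.
      rewrite minus_INR by lia. replace c with (- d - INR n) by lra. ring.
Qed.

(** * Counting zeros and poles *)

Fixpoint cnt_lt (f : nat -> R) (u : R) (n : nat) : nat :=
  match n with O => O | S m => (cnt_lt f u m + if Rlt_dec (f m) u then 1 else 0)%nat end.

Fixpoint cnt_eq (f : nat -> R) (u : R) (n : nat) : nat :=
  match n with O => O | S m => (cnt_eq f u m + if Req_dec_T (f m) u then 1 else 0)%nat end.

Lemma cnt_lt_step (f : nat -> R) (v u : R) (n : nat) :
  v < u -> (forall k, (k < n)%nat -> f k < u -> f k <= v) ->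
  cnt_lt f u n = (cnt_lt f v n + cnt_eq f v n)%nat.
Proof.
  intros Hvu. induction n; intros H; simpl; [reflexivity|].
  rewrite IHn by auto. specialize (H n ltac:(lia)).
  destruct (Rlt_dec (f n) u), (Rlt_dec (f n) v), (Req_dec_T (f n) v); try lia;
    exfalso; try specialize (H r); lra.
Qed.

Lemma cnt_lt_zero (f : nat -> R) (u : R) (n : nat) :
  (forall k, (k < n)%nat -> u <= f k) -> cnt_lt f u n = 0%nat.
Proof.
  induction n; intros H; simpl; [reflexivity|].
  rewrite IHn by auto. specialize (H n ltac:(lia)).
  destruct (Rlt_dec (f n) u); [lra|lia].
Qed.

Lemma cnt_eq_pos (f : nat -> R) (v : R) (n k : nat) :
  (k < n)%nat -> f k = v -> (0 < cnt_eq f v n)%nat.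
Proof.
  induction n; intros Hk E; simpl; [lia|].
  destruct (Nat.eq_dec k n) as [->|].
  - destruct (Req_dec_T (f n) v); [lia|contradiction].
  - specialize (IHn ltac:(lia) E). lia.
Qed.

Lemma cnt_lt_ge (f : nat -> R) (u : R) (m n : nat) :
  (m <= n)%nat -> (forall k, (k < m)%nat -> f k < u) -> (m <= cnt_lt f u n)%nat.
Proof.
  intros Hmn H. induction Hmn; simpl; [|lia].
  induction m; simpl; [lia|].
  assert (H1 := H m ltac:(lia)). destruct (Rlt_dec (f m) u); [|contradiction].
  specialize (IHm ltac:(auto)). lia.
Qed.

Lemma cnt_lt_le (f : nat -> R) (u : R) (m n : nat) :
  (forall k, (m <= k)%nat -> u <= f k) -> (cnt_lt f u n <= m)%nat.
Proof.
  intros H. enough (cnt_lt f u n <= Nat.min m n)%nat by lia.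
  induction n; simpl cnt_lt; [lia|].
  destruct (Rlt_dec (f n) u); [|lia].
  destruct (le_lt_dec m n) as [Hm|Hm]; [specialize (H n Hm); lra|lia].
Qed.

Lemma cnt_lt_ge_1 (f : nat -> R) (u : R) (n j : nat) :
  (j < n)%nat -> f j < u -> (1 <= cnt_lt f u n)%nat.
Proof.
  intros Hj H. induction n; simpl; [lia|].
  destruct (Nat.eq_dec j n) as [->|]; [|lia].
  destruct (Rlt_dec (f n) u); [lia|contradiction].
Qed.

Lemma cnt_lt_ge_2 (f : nat -> R) (u : R) (n j : nat) :
  (S j < n)%nat -> f j < u -> f (S j) < u -> (2 <= cnt_lt f u n)%nat.
Proof.
  intros Hj H1 H2. induction n; simpl; [lia|].
  destruct (Nat.eq_dec (S j) n) as [<-|]; [|lia].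
  assert (H := cnt_lt_ge_1 f u (S j) j ltac:(lia) H1).
  destruct (Rlt_dec (f (S j)) u); [lia|contradiction].
Qed.

Lemma cnt_lt_le_1 (f : nat -> R) (u : R) (n j : nat) :
  (forall k, k <> j -> u <= f k) -> (cnt_lt f u n <= 1)%nat.
Proof.
  intros H.
  (* The sharper bound, 0 as long as [n <= j], is what the induction can carry past the index
     [j]. *)
  assert (H0 : (cnt_lt f u n <= if le_lt_dec n j then 0 else 1)%nat).
  { induction n; simpl cnt_lt; [lia|].
    destruct (Rlt_dec (f n) u) as [Hn|Hn].
    - destruct (Nat.eq_dec n j) as [->|Hj]; [|specialize (H n Hj); lra].
      destruct (le_lt_dec j j), (le_lt_dec (S j) j); lia.
    - destruct (le_lt_dec n j), (le_lt_dec (S n) j); lia. }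
  destruct (le_lt_dec n j); lia.
Qed.

Lemma last_below (f : nat -> R) (u : R) (n : nat) :
  (forall k, (k < n)%nat -> u <= f k) \/
  exists j, (j < n)%nat /\ f j < u /\ forall k, (k < n)%nat -> f k < u -> f k <= f j.
Proof.
  induction n; [left; intros; lia|].
  destruct (Rlt_dec (f n) u) as [Hn|Hn].
  - right. destruct IHn as [IH|[j [Hj [Hju IH]]]].
    + exists n. split; [lia|split; [assumption|]]. intros k Hk Hku.
      destruct (Nat.eq_dec k n) as [->|]; [lra|]. specialize (IH k ltac:(lia)). lra.
    + destruct (Rle_lt_dec (f n) (f j)).
      * exists j. split; [lia|split; [assumption|]]. intros k Hk Hku.
        destruct (Nat.eq_dec k n) as [->|]; [lra|]. apply IH; [lia|assumption].
      * exists n. split; [lia|split; [assumption|]]. intros k Hk Hku.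
        destruct (Nat.eq_dec k n) as [->|]; [lra|].
        specialize (IH k ltac:(lia) Hku). lra.
  - destruct IHn as [IH|[j [Hj [Hju IH]]]].
    + left. intros k Hk. destruct (Nat.eq_dec k n) as [->|]; [lra|]. apply IH; lia.
    + right. exists j. split; [lia|split; [assumption|]]. intros k Hk Hku.
      destruct (Nat.eq_dec k n) as [->|]; [lra|]. apply IH; [lia|assumption].
Qed.

(** The limit as [e] tends to 0 of the argument of [q - (u - e * cis phi)] for [phi] in [(- PI, 0)].
    Negative reals get [- PI] and not [PI] because they are approached from the lower half-plane. *)
Definition limit_angle (phi u q : R) : R :=
  if Rlt_dec q u then - PI else if Req_dec_T q u then phi else 0.

Lemma Rsum_limit_angle (f : nat -> R) (phi u : R) (n : nat) :
  Rsum (fun k => limit_angle phi u (f k)) n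
  = - PI * INR (cnt_lt f u n) + phi * INR (cnt_eq f u n).
Proof.
  induction n; simpl; [ring|].
  rewrite IHn, !plus_INR. unfold limit_angle.
  destruct (Rlt_dec (f n) u), (Req_dec_T (f n) u); simpl; try lra.
Qed.

(* The net change of argument at a point of order [o] starting from [- PI * N]:
   for [phi] running through (-PI, 0) the angle sweeps the interval between
   [- PI * N] and [- PI * (N + o)], on which sin must stay nonnegative. *)
Lemma order_range (N o : Z) :
  (forall phi, - PI < phi < 0 -> 0 <= sin (- PI * IZR N + phi * IZR o)) ->
  (N = 0 \/ N = -1)%Z -> (N + o = 0 \/ N + o = -1)%Z.
Proof.
  intros H HN. assert (HP := PI_RGT_0).
  (* Take [phi = PI r / o]. Below, [r] is a half-integer that puts the angle at [- PI / 2] or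
     [3 PI / 2], where the sine is -1; an order [o] of the wrong sign, or of size at least 2, lets
     the sweep reach such a point. *)
  assert (T : forall r, o <> 0%Z -> -1 < r / IZR o < 0 ->
                0 <= sin (- PI * IZR N + r * PI)).
  { intros r Ho Hr. assert (Ho' : IZR o <> 0) by (now apply not_0_IZR).
    assert (E : r * PI = PI * (r / IZR o) * IZR o) by (now field).
    rewrite E. apply H. nra. }
  assert (S3 : sin (3 * (PI / 2)) = -1) by apply sin_3PI2.
  assert (S1 : sin (- (PI / 2)) = -1) by (rewrite sin_neg, sin_PI2; ring).
  destruct (Z.eq_dec o 0) as [->|Ho]; [lia|].
  assert (Pos : forall r m, (1 <= m)%Z -> (m <= o)%Z -> 0 < r < IZR m -> -1 < - r / IZR o < 0).
  { intros r m Hm Hmo Hr. apply IZR_le in Hmo.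
    assert (Hi : 0 < / IZR o) by (apply Rinv_0_lt_compat; lra).
    assert (Hio : IZR o * / IZR o = 1) by (apply Rinv_r; lra).
    unfold Rdiv. nra. }
  assert (Neg : forall r m, (1 <= m)%Z -> (o <= - m)%Z -> 0 < r < IZR m -> -1 < r / IZR o < 0).
  { intros r m Hm Hmo Hr. apply IZR_le in Hmo. rewrite opp_IZR in Hmo.
    assert (Hi : / IZR o < 0) by (apply Rinv_lt_0_compat; lra).
    assert (Hio : IZR o * / IZR o = 1) by (apply Rinv_r; lra).
    unfold Rdiv. nra. }
  destruct HN as [->| ->].
  - destruct (Z_lt_le_dec 0 o) as [H1|H1].
    + exfalso. specialize (T (- / 2) Ho (Pos (/ 2) 1%Z ltac:(lia) ltac:(lia) ltac:(simpl; lra))).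
      replace (- PI * 0 + - / 2 * PI) with (- (PI / 2)) in T by field. lra.
    + destruct (Z.eq_dec o (-1)) as [->|]; [lia|]. exfalso.
      specialize (T (3 / 2) Ho (Neg (3 / 2) 2%Z ltac:(lia) ltac:(lia) ltac:(simpl; lra))).
      replace (- PI * 0 + 3 / 2 * PI) with (3 * (PI / 2)) in T by field. lra.
  - destruct (Z_lt_le_dec o 0) as [H1|H1].
    + exfalso. specialize (T (/ 2) Ho (Neg (/ 2) 1%Z ltac:(lia) ltac:(lia) ltac:(simpl; lra))).
      replace (- PI * -1 + / 2 * PI) with (3 * (PI / 2)) in T by field. lra.
    + destruct (Z.eq_dec o 1) as [->|]; [lia|]. exfalso.
      specialize (T (- (3 / 2)) Ho (Pos (3 / 2) 2%Z ltac:(lia) ltac:(lia) ltac:(simpl; lra))).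
      replace (- PI * -1 + - (3 / 2) * PI) with (- (PI / 2)) in T by field. lra.
Qed.

Definition net_lt (f g : nat -> R) (u : R) (n : nat) : Z :=
  (Z.of_nat (cnt_lt f u n) - Z.of_nat (cnt_lt g u n))%Z.

Definition net_eq (f g : nat -> R) (u : R) (n : nat) : Z :=
  (Z.of_nat (cnt_eq f u n) - Z.of_nat (cnt_eq g u n))%Z.

(** Induction on the number of points below [u]: if [v] is the largest of them, the net count at [u]
    is the one at [v] plus the net order at [v], and [order_range] controls this jump. The ceiling
    [U] is there because, with [n] fixed, the sign hypothesis is available only for bounded [v]. *)
Lemma net_range (f g : nat -> R) (U : R) (n : nat) :
  (forall v, v <= U -> forall phi, - PI < phi < 0 ->
     0 <= sin (- PI * IZR (net_lt f g v n) + phi * IZR (net_eq f g v n))) ->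
  forall u, u <= U -> (net_lt f g u n = 0 \/ net_lt f g u n = -1)%Z.
Proof.
  intros H.
  assert (Hm : forall m u, u <= U -> (cnt_lt f u n + cnt_lt g u n <= m)%nat ->
    (net_lt f g u n = 0 \/ net_lt f g u n = -1)%Z).
  2:{ intros u Hu. now apply (Hm _ u Hu (Nat.le_refl _)). }
  assert (Step : forall m v u, v < u -> u <= U ->
    (forall k, (k < n)%nat -> f k < u -> f k <= v) ->
    (forall k, (k < n)%nat -> g k < u -> g k <= v) ->
    (0 < cnt_eq f v n + cnt_eq g v n)%nat ->
    (cnt_lt f u n + cnt_lt g u n <= S m)%nat ->
    (forall u, u <= U -> (cnt_lt f u n + cnt_lt g u n <= m)%nat ->
      (net_lt f g u n = 0 \/ net_lt f g u n = -1)%Z) ->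
    (net_lt f g u n = 0 \/ net_lt f g u n = -1)%Z).
  { intros m v u Hvu HuU Hf Hg Hpos Hle IH.
    assert (Ef := cnt_lt_step f v u n Hvu Hf). assert (Eg := cnt_lt_step g v u n Hvu Hg).
    specialize (IH v ltac:(lra) ltac:(lia)).
    assert (E : net_lt f g u n = (net_lt f g v n + net_eq f g v n)%Z)
      by (unfold net_lt, net_eq; lia).
    rewrite E. apply order_range; [|exact IH]. apply H. lra. }
  induction m; intros u Hu Hle.
  - left. unfold net_lt. lia.
  - destruct (last_below f u n) as [Zf|[i [Hi [Hiu Mf]]]];
      destruct (last_below g u n) as [Zg|[j [Hj [Hju Mg]]]].
    + left. unfold net_lt. rewrite (cnt_lt_zero f u n Zf), (cnt_lt_zero g u n Zg). lia.
    + apply (Step m (g j) u); try assumption.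
      * intros k Hk Hku. specialize (Zf k Hk). lra.
      * assert (P := cnt_eq_pos g (g j) n j Hj eq_refl). lia.
    + apply (Step m (f i) u); try assumption.
      * intros k Hk Hku. specialize (Zg k Hk). lra.
      * assert (P := cnt_eq_pos f (f i) n i Hi eq_refl). lia.
    + destruct (Rle_lt_dec (f i) (g j)).
      * apply (Step m (g j) u); try assumption.
        -- intros k Hk Hku. specialize (Mf k Hk Hku). lra.
        -- assert (P := cnt_eq_pos g (g j) n j Hj eq_refl). lia.
      * apply (Step m (f i) u); try assumption.
        -- intros k Hk Hku. specialize (Mg k Hk Hku). lra.
        -- assert (P := cnt_eq_pos f (f i) n i Hi eq_refl). lia.
Qed.

(** * Counts for the two lattices of squares *)

Lemma sq_lt (c u : R) (k : nat) : 0 <= u -> (sq c k < u ^ 2 <-> - u < c + INR k < u).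
Proof.
  intros Hu. unfold sq. split; intros H; [|nra].
  split; apply Rnot_le_lt; intros H1; nra.
Qed.

Lemma sq_ge (c u : R) (k : nat) :
  0 <= u -> c + INR k <= - u \/ u <= c + INR k -> u ^ 2 <= sq c k.
Proof. intros Hu H. unfold sq. destruct H; nra. Qed.

(** Take [u = (c + k)^2] with [k] large. Only the indices below [k] give values of [sq c] under [u],
    whereas [c - d > 1] puts [d + k + 1] below [c + k], so that all indices up to [k + 1] count for
    [sq d]. *)
Lemma cnt_excess (c d : R) :
  1 < c - d -> exists u n0, forall n, (n0 <= n)%nat ->
    (cnt_lt (sq c) u n + 2 <= cnt_lt (sq d) u n)%nat.
Proof.
  intros Hcd.
  destruct (nfloor_ex (Rabs c + Rabs d) ltac:(assert (H := Rabs_pos c); assert (H' := Rabs_pos d); lra))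
    as [N [_ HN]].
  assert (H1 := Rle_abs c). assert (H2 := Rle_abs (- c)). rewrite Rabs_Ropp in H2.
  assert (H3 := Rle_abs d). assert (H4 := Rle_abs (- d)). rewrite Rabs_Ropp in H4.
  set (k := S N). assert (Hk : INR k = INR N + 1) by apply S_INR.
  assert (HN0 := pos_INR N).
  assert (Hu : 0 <= c + INR k) by (assert (H := Rabs_pos d); lra).
  exists ((c + INR k) ^ 2), (S (S k)). intros n Hn.
  assert (A : (cnt_lt (sq c) ((c + INR k) ^ 2) n <= k)%nat).
  { apply cnt_lt_le. intros j Hj. apply le_INR in Hj. apply sq_ge; lra. }
  assert (B : (S (S k) <= cnt_lt (sq d) ((c + INR k) ^ 2) n)%nat).
  { apply cnt_lt_ge; [assumption|]. intros j Hj.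
    assert (Hj' : (j <= S k)%nat) by lia. apply le_INR in Hj'. rewrite S_INR in Hj'.
    assert (H := pos_INR j). apply sq_lt; lra. }
  lia.
Qed.

(* With zeros d+k and poles c+k, let -y1 <= 0 < y2 be the two zeros around the origin. The pole
   p between them is closer to 0 than both, or beyond the reflection of the nearer one; in the latter
   case the pole one step on the other side is also inside the interval (-max(y1,y2), max(y1,y2)). *)
Lemma cnt_deficit (c d : R) :
  0 < c - d < 1 -> c + d < 0 -> (forall n : nat, c + d <> - INR n) ->
  exists u n0, forall n, (n0 <= n)%nat -> (cnt_lt (sq d) u n < cnt_lt (sq c) u n)%nat.
Proof.
  intros Hcd Hs Hint.
  destruct (nfloor_ex (- d) ltac:(lra)) as [N [HN1 HN2]].
  set (y1 := - (d + INR N)). set (y2 := d + INR N + 1). set (p := c + INR N).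
  assert (Hle : forall k, (k <= N)%nat -> d + INR k <= - y1).
  { intros k Hk. apply le_INR in Hk. unfold y1. lra. }
  assert (Hge : forall k, (S N <= k)%nat -> y2 <= d + INR k).
  { intros k Hk. apply le_INR in Hk. rewrite S_INR in Hk. unfold y2. lra. }
  (* The non-integrality of [c + d] enters here: [p = y1] would mean [c + d = - 2 N], and [p = - y2]
     would mean [c + d = - (2 N + 1)]. *)
  assert (E1 : p <> y1).
  { intros E. apply (Hint (2 * N)%nat). rewrite mult_INR. simpl. unfold p, y1 in E. lra. }
  assert (E2 : p <> - y2).
  { intros E. apply (Hint (2 * N + 1)%nat). rewrite plus_INR, mult_INR. simpl.
    unfold p, y2 in E. lra. }
  destruct (Rle_lt_dec y1 y2) as [Hy|Hy].
  - destruct (Rlt_le_dec p y1) as [Hp|Hp].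
    + exists (y1 ^ 2), (S N). intros n Hn.
      rewrite (cnt_lt_zero (sq d)).
      * apply cnt_lt_ge_1 with (j := N); [lia|]. apply sq_lt; unfold p, y1, y2 in *; lra.
      * intros k _. apply sq_ge; [unfold y1; lra|].
        destruct (le_lt_dec k N) as [Hk|Hk]; [left; now apply Hle|].
        right. specialize (Hge k Hk). lra.
    + exists (y2 ^ 2), (S N). intros n Hn.
      (* The second pole used is the one with index [N - 1]. For [N = 0] the inequality [p >= y1]
         would read [c + d >= 0]. *)
      destruct N as [|N]; [unfold p, y1 in *; simpl in *; lra|].
      assert (A : (cnt_lt (sq d) (y2 ^ 2) n <= 1)%nat).
      { apply cnt_lt_le_1 with (j := S N). intros k Hk. apply sq_ge; [unfold y2; lra|].
        destruct (le_lt_dec k N) as [Hk'|Hk'].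
        - left. apply le_INR in Hk'. unfold y1, y2 in *. rewrite S_INR in *. lra.
        - right. apply Hge. lia. }
      assert (B : (2 <= cnt_lt (sq c) (y2 ^ 2) n)%nat).
      { apply cnt_lt_ge_2 with (j := N); [lia| |]; apply sq_lt; unfold p, y1, y2 in *;
          rewrite S_INR in *; lra. }
      lia.
  - destruct (Rlt_le_dec (- y2) p) as [Hp|Hp].
    + exists (y2 ^ 2), (S N). intros n Hn.
      rewrite (cnt_lt_zero (sq d)).
      * apply cnt_lt_ge_1 with (j := N); [lia|]. apply sq_lt; unfold p, y1, y2 in *; lra.
      * intros k _. apply sq_ge; [unfold y2; lra|].
        destruct (le_lt_dec k N) as [Hk|Hk]; [left; specialize (Hle k Hk); lra|].
        right. now apply Hge.
    (* Here the second pole is [p + 1]: it lies below [y1] because [p < - y2] and [y1 + y2 = 1]. *)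
    + exists (y1 ^ 2), (S (S N)). intros n Hn.
      assert (A : (cnt_lt (sq d) (y1 ^ 2) n <= 1)%nat).
      { apply cnt_lt_le_1 with (j := S N). intros k Hk. apply sq_ge; [unfold y1; lra|].
        destruct (le_lt_dec k N) as [Hk'|Hk'].
        - left. now apply Hle.
        - right. assert (Hk2 : (S (S N) <= k)%nat) by lia.
          apply le_INR in Hk2. rewrite !S_INR in Hk2. unfold y1, y2 in *. lra. }
      assert (B : (2 <= cnt_lt (sq c) (y1 ^ 2) n)%nat).
      { apply cnt_lt_ge_2 with (j := N); [lia| |]; apply sq_lt; unfold p, y1, y2 in *;
          rewrite ?S_INR in *; lra. }
      lia.
Qed.

(** * Boundary behaviour at real points *)

Definition cis (phi : R) : C := (cos phi, sin phi).

Lemma Cmod_cis (phi : R) : Cmod (cis phi) = 1.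
Proof.
  destruct (polar_Cmod (cis phi) phi) as [Hp E].
  { exists 1. split; [lra|]. unfold cis. now rewrite !Rmult_1_l. }
  assert (H := Cmod2_alt (cis phi)). unfold cis in H at 2 3. simpl Re in H. simpl Im in H.
  assert (H1 := sin2_cos2 phi). unfold Rsqr in H1. nra.
Qed.

(* [q - (u - e cis phi)] rescaled by a positive factor so as to keep a nonzero limit as e -> 0. *)
Definition scaled (phi u e q : R) : C :=
  if Req_dec_T q u then cis phi else (RtoC q - (RtoC u - RtoC e * cis phi))%C.

Lemma scaled_spec (phi u e q : R) :
  0 < e -> exists r : R, 0 < r /\ (RtoC q - (RtoC u - RtoC e * cis phi))%C = (r * scaled phi u e q)%C.
Proof.
  intros He. unfold scaled. destruct (Req_dec_T q u) as [->|H].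
  - exists e. split; [assumption|ring].
  - exists 1. split; [lra|ring].
Qed.

Lemma polar_cis (phi : R) : polar (cis phi) phi.
Proof. exists 1. split; [lra|]. unfold cis. now rewrite !Rmult_1_l. Qed.

Lemma polar_neg (x : R) : x < 0 -> polar x (- PI).
Proof.
  intros Hx. exists (- x). split; [lra|]. rewrite cos_neg, sin_neg, cos_PI, sin_PI.
  apply injective_projections; simpl; ring.
Qed.

Lemma scaled_limit (phi u q : R) :
  exists l : C, polar l (limit_angle phi u q) /\
    Cconv (fun m => scaled phi u (/ INR (S m)) q) l.
Proof.
  unfold scaled, limit_angle. destruct (Req_dec_T q u) as [->|H].
  - exists (cis phi). split; [|apply Cconv_const].
    destruct (Rlt_dec u u); [lra|]. apply polar_cis.
  - exists (RtoC (q - u)). split.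
    + destruct (Rlt_dec q u); [apply polar_neg; lra|apply polar_pos; lra].
    + apply Cconv_Cmod_minus.
      apply is_lim_seq_ext with (fun m => / INR (S m)).
      * intros m.
        assert (Hm : 0 < / INR (S m)) by (apply Rinv_0_lt_compat, lt_0_INR; lia).
        set (e := / INR (S m)) in *.
        replace (q - (u - e * cis phi) - RtoC (q - u))%C with (RtoC e * cis phi)%C
          by (rewrite RtoC_minus; ring).
        rewrite Cmod_mult, Cmod_cis, Cmod_R, Rabs_pos_eq; lra.
      * apply (is_lim_seq_incr_1 (fun n => / INR n)), is_lim_seq_inv_INR.
Qed.

Lemma Cprod_limit (f : nat -> nat -> C) (a : nat -> R) (n : nat) :
  (forall k, exists l : C, polar l (a k) /\ Cconv (fun m => f m k) l) ->
  exists l : C, polar l (Rsum a n) /\ Cconv (fun m => Cprod (f m) n) l.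
Proof.
  intros H. induction n as [|n [l [Hl HC]]]; simpl.
  - exists (RtoC 1). split; [apply polar_pos, Rlt_0_1|apply Cconv_const].
  - destruct (H n) as [l' [Hl' HC']]. exists (l * l')%C.
    split; [now apply polar_mult|now apply Cconv_mult].
Qed.

Definition scaled_ratio (c d phi u e : R) (k : nat) : C :=
  (scaled phi u e (sq d k) / scaled phi u e (sq c k))%C.

Lemma Cprod_pos_scal (f g : nat -> C) (n : nat) :
  (forall k, exists r : R, 0 < r /\ f k = (r * g k)%C) ->
  exists r : R, 0 < r /\ Cprod f n = (r * Cprod g n)%C.
Proof.
  intros H. induction n as [|n [r [Hr IH]]]; simpl.
  - exists 1. split; [lra|ring].
  - destruct (H n) as [s [Hs E]]. exists (r * s). split; [now apply Rmult_lt_0_compat|].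
    rewrite IH, E, RtoC_mult. ring.
Qed.

Lemma Gfactor_scaled (c d phi u e : R) (k : nat) :
  0 < e -> (RtoC (sq c k) - (RtoC u - RtoC e * cis phi))%C <> 0 ->
  exists r : R, 0 < r /\
    Gfactor c d (RtoC u - RtoC e * cis phi) k = (r * scaled_ratio c d phi u e k)%C.
Proof.
  intros He Hn.
  destruct (scaled_spec phi u e (sq d k) He) as [r1 [H1 E1]].
  destruct (scaled_spec phi u e (sq c k) He) as [r2 [H2 E2]].
  exists (r1 / r2). split; [now apply Rdiv_lt_0_compat|].
  unfold Gfactor, scaled_ratio. rewrite E1, E2, RtoC_div by lra.
  rewrite E2 in Hn.
  assert (Hr2 : RtoC r2 <> 0) by (intros E; apply RtoC_inj in E; lra).
  field. split; [|exact Hr2]. intros E. apply Hn. rewrite E. ring.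
Qed.

Lemma im_nonneg_lim (u : nat -> C) (l : C) (v : nat -> R) :
  Cconv u l -> is_lim_seq v 0 ->
  eventually (fun m => 0 <= Im (u m) + Cmod (u m) * v m) -> 0 <= Im l.
Proof.
  intros Hu Hv He.
  replace (Im l) with (Im l + Cmod l * 0) by ring.
  apply (is_lim_seq_le_loc (fun _ => 0) (fun m => Im (u m) + Cmod (u m) * v m) 0
           (Im l + Cmod l * 0)); [exact He|apply is_lim_seq_const|].
  apply is_lim_seq_plus'; [exact (proj2 Hu)|].
  apply is_lim_seq_mult'; [now apply Cconv_Cmod|exact Hv].
Qed.

(* Near a real point u the factors with index >= n0 are positive at u and vary little, so the sign of
   Im (K G) at u - e cis phi is governed, as e -> 0, by the first n0 factors. *)
Lemma local_sign (c d K u : R) (n0 : nat) :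
  (forall w, 0 < Im w -> exists L, Cconv (Gn c d w) L /\ 0 < Im (K * L)%C) ->
  (forall k, (n0 <= k)%nat -> / 16 * (INR k + 1) ^ 2 <= sq c k - u) ->
  (forall k, (n0 <= k)%nat -> / 16 * (INR k + 1) ^ 2 <= sq d k - u) ->
  forall phi, - PI < phi < 0 ->
  0 <= K * sin (- PI * IZR (net_lt (sq d) (sq c) u n0) + phi * IZR (net_eq (sq d) (sq c) u n0)).
Proof.
  intros HL Hc Hd phi Hphi.
  assert (Far : forall x, (forall k, (n0 <= k)%nat -> / 16 * (INR k + 1) ^ 2 <= sq x k - u) ->
                  far_from x n0 u (/ 16)).
  { intros x Hx j. specialize (Hx (n0 + j)%nat ltac:(lia)).
    rewrite <- RtoC_minus, Cmod_R. eapply Rle_trans; [|apply Rle_abs].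
    eapply Rle_trans; [|exact Hx]. apply Rmult_le_compat_l; [lra|].
    rewrite S_INR, plus_INR. assert (H := pos_INR n0). assert (H' := pos_INR j).
    apply pow_incr. lra. }
  destruct (kern_bound c d n0 u (/ 16) ltac:(lra) (Far c Hc) (Far d Hd)) as [A [HA HK]].
  destruct (Cprod_limit (fun m => scaled_ratio c d phi u (/ INR (S m)))
              (fun k => limit_angle phi u (sq d k) - limit_angle phi u (sq c k)) n0)
    as [l [Hl HC]].
  { intros k.
    destruct (scaled_limit phi u (sq d k)) as [l1 [P1 C1]].
    destruct (scaled_limit phi u (sq c k)) as [l2 [P2 C2]].
    exists (l1 / l2)%C. split; [now apply polar_div|].
    apply Cconv_div; try assumption. now apply (polar_neq_0 l2 _ P2). }
  rewrite Rsum_minus, !Rsum_limit_angle in Hl.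
  replace (- PI * IZR (net_lt (sq d) (sq c) u n0) + phi * IZR (net_eq (sq d) (sq c) u n0))
    with (- PI * INR (cnt_lt (sq d) u n0) + phi * INR (cnt_eq (sq d) u n0) -
          (- PI * INR (cnt_lt (sq c) u n0) + phi * INR (cnt_eq (sq c) u n0)))
    by (unfold net_lt, net_eq; rewrite !minus_IZR, <- !INR_IZR_INZ; ring).
  set (th := _ - _) in *.
  assert (Him : 0 <= Im (K * l)%C).
  2:{ destruct (polar_Cmod l th Hl) as [Hp E]. rewrite im_scal_l in Him.
      rewrite (f_equal Im E : Im l = Cmod l * sin th) in Him.
      set (s := sin th) in *. apply Rnot_lt_le. intros Hn.
      assert (0 < Cmod l * - (K * s)) by (apply Rmult_lt_0_compat; lra). nra. }
  apply im_nonneg_lim with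
    (u := fun m => (K * Cprod (scaled_ratio c d phi u (/ INR (S m))) n0)%C)
    (v := fun m => 2 * A * / INR (S m)).
  { apply Cconv_mult; [apply Cconv_const|exact HC]. }
  { replace 0 with (2 * A * 0) by ring.
    apply is_lim_seq_mult'; [apply is_lim_seq_const|].
    apply (is_lim_seq_incr_1 (fun n => / INR n)), is_lim_seq_inv_INR. }
  (* Then [e = / INR (S m)] satisfies [e <= / 16 / 2], the range of [h] in [kern_bound], and
     [e * A <= 1], the smallness needed for the product estimate. *)
  destruct (nfloor_ex (32 + A) ltac:(lra)) as [M [_ HM]].
  exists M. intros m Hm.
  set (e := / INR (S m)). set (h := (- (RtoC e * cis phi))%C).
  assert (Hm1 : 32 + A < INR (S m)) by (apply le_INR in Hm; rewrite S_INR; lra).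
  assert (He : 0 < e) by (apply Rinv_0_lt_compat; lra).
  assert (Hem : e * INR (S m) = 1) by (apply Rinv_l; lra).
  assert (Hh : Cmod h = e).
  { unfold h. rewrite Cmod_opp, Cmod_mult, Cmod_cis, Cmod_R, Rabs_pos_eq; lra. }
  assert (Hh1 : Cmod h <= / 16 / 2) by (rewrite Hh; nra).
  set (w := (RtoC u + h)%C).
  assert (Ew : w = (RtoC u - RtoC e * cis phi)%C) by (unfold w, h; ring).
  assert (Hw : 0 < Im w).
  { assert (Hs : sin phi < 0) by (apply sin_lt_0_var; lra).
    assert (Ei : Im w = - (e * sin phi)) by (unfold w, h, cis, Im; simpl; ring).
    rewrite Ei. clear - He Hs. nra. }
  destruct (HL w Hw) as [L [HLc HLi]].
  (* Positivity is an open condition, so a single finite partial product inherits it. Its length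
     depends on [m], which is harmless because the bound on [V - 1] below does not depend on the
     length. *)
  assert (Hev : eventually (fun n => 0 < Im (K * Gn c d w n)%C)).
  { assert (H := proj2 (Cconv_mult _ _ _ _ (Cconv_const K) HLc)).
    apply is_lim_seq_spec in H. destruct (H (mkposreal _ HLi)) as [n1 Hn1].
    exists n1. intros n Hn. specialize (Hn1 n Hn).
    change (Rabs (Im (K * Gn c d w n)%C - Im (K * L)%C) < Im (K * L)%C) in Hn1.
    apply Rabs_def2 in Hn1. lra. }
  destruct Hev as [n1 Hn1]. specialize (Hn1 (n0 + n1)%nat ltac:(lia)).
  set (R0 := Cprod (scaled_ratio c d phi u e) n0).
  set (V := Cprod (fun j => 1 + h * kern c d u h (n0 + j))%C (S n1)).
  assert (HG : exists r : R, 0 < r /\ Gn c d w (n0 + n1) = (r * (R0 * V))%C).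
  { destruct (Cprod_pos_scal (Gfactor c d w) (scaled_ratio c d phi u e) n0) as [r1 [Hr1 E1]].
    { intros k. rewrite Ew. apply Gfactor_scaled; [assumption|].
      rewrite <- Ew. apply RtoC_minus_neq_0. lra. }
    destruct (Cprod_pos_scal (fun j => Gfactor c d w (n0 + j))
                (fun j => 1 + h * kern c d u h (n0 + j))%C (S n1)) as [r2 [Hr2 E2]].
    { intros k. assert (Hck := Hc (n0 + k)%nat ltac:(lia)). assert (Hdk := Hd (n0 + k)%nat ltac:(lia)).
      assert (Hk : 0 < / 16 * (INR (n0 + k) + 1) ^ 2).
      { assert (H := pos_INR (n0 + k)). nra. }
      exists ((sq d (n0 + k) - u) / (sq c (n0 + k) - u)).
      split; [apply Rdiv_lt_0_compat; lra|].
      destruct (far_from_neq c n0 u h (/ 16) ltac:(lra) (Far c Hc) Hh1 k) as [_ N1].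
      unfold w. rewrite Gfactor_shift; [|rewrite <- RtoC_minus..|exact N1].
      - unfold Gfactor. rewrite RtoC_div, !RtoC_minus by lra. reflexivity.
      - intros E. apply RtoC_inj in E. lra.
      - intros E. apply RtoC_inj in E. lra. }
    exists (exp (2 * (c - d) * ln (INR (n0 + n1))) * r1 * r2).
    split; [repeat apply Rmult_lt_0_compat; try assumption; apply exp_pos|].
    unfold Gn. replace (S (n0 + n1)) with (n0 + S n1)%nat by lia.
    rewrite Cprod_add, E1, E2, !RtoC_mult. unfold R0, V. ring. }
  destruct HG as [r [Hr EG]]. rewrite EG in Hn1.
  assert (Hpos : 0 < Im (K * R0 * V)%C).
  { replace (K * (r * (R0 * V)))%C with (r * (K * R0 * V))%C in Hn1 by ring.
    rewrite im_scal_l in Hn1. nra. }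
  assert (HV : Cmod (V - 1) <= 2 * A * e).
  { set (t := fun j => Cmod h * (A * / (INR (S j) * INR (S (S j))))).
    assert (HT : Rsum t (S n1) <= Cmod h * A).
    { rewrite (Rsum_ext t (fun j => (Cmod h * A) * / (INR (S j) * INR (S (S j))))).
      - apply Rsum_recip_le. assert (H := Cmod_ge_0 h). nra.
      - intros k _. unfold t. ring. }
    assert (HeA : e * A <= 1) by nra.
    eapply Rle_trans.
    - apply Cprod_one_plus_near_1 with (t := t).
      + intros j. rewrite Cmod_mult. apply Rmult_le_compat_l; [apply Cmod_ge_0|]. now apply HK.
      + rewrite Hh in HT. lra.
    - rewrite Hh in HT. lra. }
  replace (K * R0 * V)%C with (K * R0 + K * R0 * (V - 1))%C in Hpos by ring.
  rewrite im_plus in Hpos.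
  assert (H1 := im_le_Cmod (K * R0 * (V - 1))%C). rewrite Cmod_mult in H1.
  assert (H2 := Rle_abs (Im (K * R0 * (V - 1))%C)).
  assert (H3 := Cmod_ge_0 (K * R0)%C).
  fold R0. nra.
Qed.

(** For [K < 0] the zeros and poles are exchanged: this negates the angle, and the oddness of the
    sine compensates the sign of [K]. The threshold [n0] chosen for [u] also serves every
    [v <= u]. *)
Lemma net_range_of_positive_Im (c d K : R) :
  (forall w, 0 < Im w -> exists L, Cconv (Gn c d w) L /\ 0 < Im (K * L)%C) ->
  forall u, exists n0, forall n, (n0 <= n)%nat ->
    (0 < K -> (net_lt (sq d) (sq c) u n = 0 \/ net_lt (sq d) (sq c) u n = -1)%Z) /\
    (K < 0 -> (net_lt (sq d) (sq c) u n = 0 \/ net_lt (sq d) (sq c) u n = 1)%Z).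
Proof.
  intros HL u.
  destruct (sq_growth c u) as [Nc Hc]. destruct (sq_growth d u) as [Nd Hd].
  exists (Nc + Nd)%nat. intros n Hn.
  assert (S : forall v, v <= u -> forall phi, - PI < phi < 0 ->
    0 <= K * sin (- PI * IZR (net_lt (sq d) (sq c) v n) + phi * IZR (net_eq (sq d) (sq c) v n))).
  { intros v Hv. apply local_sign; [exact HL| |].
    - intros k Hk. specialize (Hc k ltac:(lia)). lra.
    - intros k Hk. specialize (Hd k ltac:(lia)). lra. }
  split; intros HK.
  - apply (net_range _ _ u); [|lra]. intros v Hv phi Hphi.
    specialize (S v Hv phi Hphi). nra.
  - enough (net_lt (sq c) (sq d) u n = 0 \/ net_lt (sq c) (sq d) u n = -1)%Z
      by (unfold net_lt in *; lia).
    apply (net_range _ _ u); [|lra]. intros v Hv phi Hphi.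
    specialize (S v Hv phi Hphi).
    replace (net_lt (sq c) (sq d) v n) with (- net_lt (sq d) (sq c) v n)%Z
      by (unfold net_lt; lia).
    replace (net_eq (sq c) (sq d) v n) with (- net_eq (sq d) (sq c) v n)%Z
      by (unfold net_eq; lia).
    rewrite !opp_IZR.
    set (x := IZR (net_lt _ _ _ _)) in *. set (y := IZR (net_eq _ _ _ _)) in *.
    replace (- PI * - x + phi * - y) with (- (- PI * x + phi * y)) by ring.
    rewrite sin_neg. nra.
Qed.

(** * Both directions, from the sign of [K] and the counts *)

Theorem theorem8p1 (alpha beta : R) (hbeta : forall k : Z, beta <> IZR k) :
  Herglotz (m_hat alpha beta) <->
  ((exists n : nat, alpha = - INR (S n)) \/ -1 < alpha) /\
  ((-1 < beta < 0) \/ (0 < beta < 1)).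
Proof.
  destruct (m_hat_limit alpha beta hbeta) as [K [HK [HKs Hm]]].
  set (c := (1 + alpha + beta) / 2) in *. set (d := (1 + alpha - beta) / 2) in *.
  assert (Hcd : c - d = beta) by (unfold c, d; field).
  assert (Hcd' : c + d = 1 + alpha) by (unfold c, d; field).
  assert (HK0 : RtoC K <> 0) by (intros E; apply HK; now apply RtoC_inj).
  assert (Hshift : forall w, Im (w - RtoC (c ^ 2))%C = Im w).
  { intros w. unfold Im; simpl; ring. }
  split.
  - intros H.
    assert (HL : forall w, 0 < Im w -> exists L, Cconv (Gn c d w) L /\ 0 < Im (K * L)%C).
    { intros w Hw. assert (Hz : 0 < Im (w - RtoC (c ^ 2))%C) by now rewrite Hshift.
      destruct (Hm (w - RtoC (c ^ 2))%C ltac:(lra)) as [L [_ [HC E]]].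
      replace (RtoC (c ^ 2) + (w - RtoC (c ^ 2)))%C with w in HC by ring.
      exists L. split; [exact HC|]. rewrite <- E. now apply H. }
    assert (HN := net_range_of_positive_Im c d K HL).
    assert (H0 : beta <> 0) by apply (hbeta 0%Z).
    assert (H1 : beta <> 1) by apply (hbeta 1%Z).
    assert (H2 : beta <> -1) by apply (hbeta (-1)%Z).
    (* The sign of [K] is not known yet, but a net count of size at least 2 contradicts both of its
       cases. *)
    assert (Hb : -1 < beta < 1).
    { split; apply Rnot_le_lt; intros Hb.
      - destruct (cnt_excess d c ltac:(lra)) as [u [n1 Hu]].
        destruct (HN u) as [n0 Hn0].
        specialize (Hu (n0 + n1)%nat ltac:(lia)).
        destruct (Hn0 (n0 + n1)%nat ltac:(lia)) as [P Q]. unfold net_lt in P, Q.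
        destruct (Rdichotomy _ _ HK) as [Hk|Hk]; [specialize (Q Hk)|specialize (P Hk)]; lia.
      - destruct (cnt_excess c d ltac:(lra)) as [u [n1 Hu]].
        destruct (HN u) as [n0 Hn0].
        specialize (Hu (n0 + n1)%nat ltac:(lia)).
        destruct (Hn0 (n0 + n1)%nat ltac:(lia)) as [P Q]. unfold net_lt in P, Q.
        destruct (Rdichotomy _ _ HK) as [Hk|Hk]; [specialize (Q Hk)|specialize (P Hk)]; lia. }
    specialize (HKs Hb).
    split; [|lra].
    destruct (Rlt_le_dec (-1) alpha) as [Ha|Ha]; [now right|left].
    apply Classical_Prop.NNPP. intros Hno.
    assert (Hint : forall n : nat, c + d <> - INR n).
    { intros n E. apply Hno. exists n. rewrite S_INR. lra. }
    assert (Hs : c + d < 0) by (specialize (Hint O); simpl in Hint; lra).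
    (* For [beta > 0], [K < 0] forbids more poles than zeros below any point, which [cnt_deficit]
       produces; for [beta < 0], [K > 0] and the roles of zeros and poles are exchanged. *)
    destruct (Rlt_le_dec 0 beta) as [Hb0|Hb0].
    + destruct (cnt_deficit c d ltac:(lra) Hs Hint) as [u [n1 Hu]].
      destruct (HN u) as [n0 Hn0].
      specialize (Hu (n0 + n1)%nat ltac:(lia)).
      destruct (Hn0 (n0 + n1)%nat ltac:(lia)) as [_ Q]. unfold net_lt in Q.
      specialize (Q ltac:(nra)). lia.
    + rewrite Rplus_comm in Hs.
      destruct (cnt_deficit d c ltac:(lra) Hs) as [u [n1 Hu]].
      { intros n. rewrite Rplus_comm. apply Hint. }
      destruct (HN u) as [n0 Hn0].
      specialize (Hu (n0 + n1)%nat ltac:(lia)).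
      destruct (Hn0 (n0 + n1)%nat ltac:(lia)) as [P _]. unfold net_lt in P.
      specialize (P ltac:(nra)). lia.
  - intros [Ha Hb] z Hz. specialize (HKs ltac:(lra)).
    assert (Hsum : 0 < c + d \/ exists n : nat, c + d = - INR n).
    { destruct Ha as [[n Hn]|Ha]; [right; exists n|left; lra].
      rewrite S_INR in Hn. lra. }
    split.
    (* Translating by [c^2] and dividing by [K] turns [m_hat] into the bare limit of [Gn], to which
       the local expansion applies. *)
    + set (F := fun w : C => (m_hat alpha beta (w - RtoC (c ^ 2)) / K)%C).
      assert (HF : forall v, Im v > 0 -> Cconv (Gn c d v) (F v)).
      { intros v Hv. assert (Hz' : 0 < Im (v - RtoC (c ^ 2))%C) by (rewrite Hshift; lra).
        destruct (Hm (v - RtoC (c ^ 2))%C ltac:(lra)) as [L [_ [HC E]]].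
        replace (RtoC (c ^ 2) + (v - RtoC (c ^ 2)))%C with v in HC by ring.
        unfold F. rewrite E. replace (K * L / K)%C with L by (now field). exact HC. }
      assert (Hw : Im (RtoC (c ^ 2) + z)%C > 0).
      { rewrite im_plus, im_RtoC. lra. }
      destruct (Gn_limit_expansion c d F _ Hw HF) as [D [B [delta [Hdl [HB HE]]]]].
      exists (K * D)%C.
      apply is_C_derive_of_quadratic_error with (B := Rabs K * B) (delta := delta);
        [exact Hdl|apply Rmult_le_pos; [apply Rabs_pos|exact HB]|].
      intros h Hh. specialize (HE h Hh).
      unfold F in HE.
      replace (RtoC (c ^ 2) + z + h - RtoC (c ^ 2))%C with (z + h)%C in HE by ring.
      replace (RtoC (c ^ 2) + z - RtoC (c ^ 2))%C with z in HE by ring.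
      replace (m_hat alpha beta (z + h) - m_hat alpha beta z - h * (K * D))%C
        with (K * (m_hat alpha beta (z + h) / K - m_hat alpha beta z / K - h * D))%C
        by (now field).
      rewrite Cmod_mult, Cmod_R, Rmult_assoc.
      apply Rmult_le_compat_l; [apply Rabs_pos|exact HE].
    + destruct (Hm z ltac:(lra)) as [L [HL0 [HC E]]].
      rewrite E, im_scal_l.
      assert (Hw : 0 < Im (RtoC (c ^ 2) + z)%C) by (rewrite im_plus, im_RtoC; lra).
      destruct Hb as [Hb|Hb].
      * assert (Hi : Im (/ L) < 0).
        { apply (Im_limit_neg d c (RtoC (c ^ 2) + z) (/ L)); [lra| |exact Hw|now apply Cinv_neq_0|].
          - now rewrite Rplus_comm.
          - apply Cconv_Gn_swap; [lra|assumption|exact HC]. }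
        apply (Im_inv_neg L HL0) in Hi. nra.
      * assert (Hi := Im_limit_neg c d _ L ltac:(lra) Hsum Hw HL0 HC). nra.
Qed.
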